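(* Let $\mathcal{A}$ be a spectral algebra, $0<p_0\le1$, $\omega$ an $(\mathcal{A},p_0)$-admissible weight, $T=(T_k)_{k\in X}$ a g-frame for $\mathcal{H}$ and $T^d=(T^d_k)_{k\in X}$ a dual g-frame of $T$ such that $T^d\sim_{\mathcal{A}}T$. Then the space $\mathcal{H}^p_\omega(T^d,T)$ is a Banach space for each $p\in[1,\infty]\cup\{0\}$ and a quasi-Banach space for $p_0<p<1$. Moreover, $C_{T^d}$ is an isometry $\mathcal{H}^p_\omega(T^d,T)\to\ell^p_\omega(X;\mathcal{H})$ for all $p\in(p_0,\infty]\cup\{0,1\}$.
   Context: $\mathcal{H}$ is a separable Hilbert space, $X\subset\mathbb{R}^d$ is countable; a weight is a continuous function $\omega:\mathbb{R}^d\to(0,\infty)$. g-frames. $T=(T_k)_{k\in X}\subset\mathcal{B}(\mathcal{H})$ is a g-frame if $A\|f\|^2\le\sum_k\|T_kf\|^2\le B\|f\|^2$ for all $f\in\mathcal H$ and some $0<A\le B<\infty$; it is g-Bessel if the upper bound holds. A dual g-frame of $T$ is a g-Bessel sequence $T^d=(T^d_k)_{k\in X}$ with $f=\sum_kT_k^*T^d_kf=\sum_k(T^d_k)^*T_kf$ for all $f\in\mathcal{H}$ (it is then itself a g-frame). $C_{T^d}f=(T^d_kf)_{k\in X}$, $D_T(f_k)_k=\sum_kT_k^*f_k$. Sequence spaces. For $0<p\le\infty$, $\ell^p_\omega(X;\mathcal{H})$ consists of $\mathcal{H}$-valued $(f_k)_{k\in X}$ with $\|(f_k)\|_{\ell^p_\omega(X;\mathcal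 H)}=\|(\|f_k\|\omega(k))_k\|_{\ell^p(X)}<\infty$. $\ell^{00}(X;\mathcal{H})$ is the space of finitely supported sequences and $\ell^0_\omega(X;\mathcal{H})$ its closure in $\ell^\infty_\omega(X;\mathcal{H})$, with the $\ell^\infty_\omega$-norm. Spectral algebra. A unital Banach *-algebra $\mathcal{A}$ of $\mathcal{B}(\mathcal{H})$-valued matrices $[A_{k,l}]_{k,l\in X}$ (matrix product, involution $[A_{k,l}]^*=[A_{l,k}^*]_{k,l}$, action $(Af)_k=\sum_lA_{k,l}f_l$) such that (1) $\mathcal{A}\subseteq\mathcal{B}(\ell^2(X;\mathcal{H}))$ via a unital *-monomorphism; (2) $A\in\mathcal{A}$ invertible in $\mathcal{B}(\ell^2(X;\mathcal{H}))$ implies $A^{-1}\in\mathcal{A}$; (3) $A\in\mathcal{A}$ and $\|B_{k,l}\|\le\|A_{k,l}\|$ for all $k,l$ imply $B\in\mathcal{A}$, $\|B\|_{\mathcal{A}}\le\|A\|_{\mathcal{A}}$. $U\sim_{\mathcal{A}}T$ means $[U_kT_l^*]_{k,l\in X}\in\mathcal{A}$. A weight $\omega$ is $(\mathcal{A},p_0)$-admissible if every $A\in\mathcal{A}$ defines a bounded operator on $\ell^p_\omega(X;\mathcal{H})$ for every $p\in(p_0,\infty]\cup\{1\}$. The spaces $\mathcal{H}^p_\omega(T^d,T)$. Let $\mathcal{H}^{00}(T)=D_T(\ell^{00}(X;\mathcal{H}))$. For $p\in(p_0,\infty)\cup\{0,1\}$, $\mathcal{H}^p_\omega(T^d,T)$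 is the completion of $\mathcal{H}^{00}(T)$ with respect to $\|f\|_{\mathcal{H}^p_\omega(T^d,T)}=\|C_{T^d}f\|_{\ell^p_\omega(X;\mathcal{H})}$, and $C_{T^d}$ on it is the extension by density from $\mathcal{H}^{00}(T)$. For $p=\infty$: two sequences $\{f_n\},\{g_n\}$ in $\mathcal{H}$ are $(T^d,\omega)$-equivalent ($\sim_{T^d,\omega}$) if $\lim_n\|T^d_k(f_n-g_n)\|=0$ for all $k\in X$ and $\sup_n\|C_{T^d}(f_n-g_n)\|_{\ell^\infty_\omega(X;\mathcal{H})}<\infty$. $\mathcal{H}^\infty_\omega(T^d,T)$ is the space of classes $f=[\{f_n\}]_{\sim_{T^d,\omega}}$ such that $T^d_kf:=\lim_nT^d_kf_n$ exists in $\mathcal{H}$ for each $k$ and $\sup_n\|C_{T^d}f_n\|_{\ell^\infty_\omega(X;\mathcal{H})}<\infty$; $C_{T^d}f:=(T^d_kf)_{k\in X}$ and $\|f\|_{\mathcal{H}^\infty_\omega(T^d,T)}=\sup_k\|T^d_kf\|\omega(k)$. *)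

(* Defs.v *)
From HB Require Import structures.
From mathcomp Require Import all_boot all_order all_algebra finmap.
From mathcomp Require Import generic_quotient ring_quotient.
From mathcomp Require Import complex.
From mathcomp.analysis Require Import showcase.summability.
From mathcomp Require Import all_classical all_reals all_analysis.

Set Implicit Arguments.
Unset Strict Implicit.
Unset Printing Implicit Defensive.

Import Order.TTheory GRing.Theory Num.Theory.
Import numFieldNormedType.Exports.

Local Open Scope classical_set_scope.
Local Open Scope ring_scope.
Local Open Scope quotient_scope.

Section Subspace.
Context {K : numFieldType} {V : lmodType K}.

Record subspace := Subspace {
  subspace_set : set V ;
  subspace_closed : subspace_set 0 /\ forall (a : K) (x y : V),
    subspace_set x -> subspace_set y -> subspace_set (a *: x + y) }.

Definition subspace_mem (S : subspace) : {pred V} :=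
  fun x => `[< subspace_set S x >].

Lemma subspace_mem_closed (S : subspace) : submod_closed (subspace_mem S).
Proof.
have [S0 SD] := subspace_closed S; split; first exact/asboolP.
by move=> a x y /asboolP xS /asboolP yS; apply/asboolP/SD.
Qed.

Lemma mem_subspace (S : subspace) x :
  subspace_set S x -> x \in subspace_mem S.
Proof. by move=> Sx; exact/asboolP. Qed.

HB.instance Definition _ (S : subspace) :=
  GRing.isSubmodClosed.Build K V (subspace_mem S) (subspace_mem_closed S).

Record subspace_type (S : subspace) := SubspaceType {
  subspace_val : V ; _ : subspace_val \in subspace_mem S }.

HB.instance Definition _ (S : subspace) :=
  [isSub of subspace_type S for @subspace_val S].
HB.instance Definition _ (S : subspace) :=
  [Choice of subspace_type S by <:].
HB.instance Definition _ (S : subspace) :=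
  [SubChoice_isSubLmodule of subspace_type S by <:].

End Subspace.
Arguments subspace {K} V.

Section SubQuotient.
Context {K : numFieldType} {V : lmodType K}.
Variables G N : subspace V.

Definition relative_set : set (subspace_type G) :=
  fun x => subspace_set N (val x).

Lemma relative_closed : relative_set 0 /\
  forall (a : K) (x y : subspace_type G),
    relative_set x -> relative_set y -> relative_set (a *: x + y).
Proof.
have [N0 ND] := subspace_closed N; split; first exact: N0.
by move=> a x y xN yN; exact: ND.
Qed.

Definition relative := Subspace relative_closed.

(* G modulo N; N need not be contained in G. *)
Definition subquotient := Quotient.quot (subspace_mem relative).

HB.instance Definition _ := GRing.Zmodule.on subquotient.
HB.instance Definition _ : EqQuotient _ _ subquotient :=
  EqQuotient.on subquotient.

Definition subquotient_scale (a : K) (q : subquotient) : subquotient :=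
  \pi_subquotient (a *: repr q).

Lemma subquotient_piP (x y : subspace_type G) :
  (\pi_subquotient x = \pi_subquotient y) <-> (x - y \in subspace_mem relative).
Proof.
rewrite (Quotient.idealrBE (subspace_mem relative)); split => [->//|/eqP //].
Qed.

Lemma subquotient_pi_scale (a : K) (x : subspace_type G) :
  subquotient_scale a (\pi_subquotient x) = \pi_subquotient (a *: x).
Proof.
apply/subquotient_piP; rewrite -scalerBr rpredZ//.
by apply/subquotient_piP; rewrite reprK.
Qed.

Lemma subquotient_pi_add (x y : subspace_type G) :
  (\pi_subquotient x + \pi_subquotient y) = \pi_subquotient (x + y).
Proof.
symmetry; exact: Quotient.pi_add.
Qed.

Lemma subquotient_surj (q : subquotient) : exists x, q = \pi_subquotient x.
Proof. by exists (repr q); rewrite reprK. Qed.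

Lemma subquotient_scaleA (a b : K) (q : subquotient) :
  subquotient_scale a (subquotient_scale b q) = subquotient_scale (a * b) q.
Proof.
by have [x ->] := subquotient_surj q; rewrite !subquotient_pi_scale scalerA.
Qed.

Lemma subquotient_scale1 : left_id 1 subquotient_scale.
Proof.
move=> q; have [x ->] := subquotient_surj q.
by rewrite subquotient_pi_scale scale1r.
Qed.

Lemma subquotient_scaleDr : right_distributive subquotient_scale +%R.
Proof.
move=> a q r; have [x ->] := subquotient_surj q.
have [y ->] := subquotient_surj r.
rewrite subquotient_pi_add !subquotient_pi_scale subquotient_pi_add.
by rewrite scalerDr.
Qed.

Lemma subquotient_scaleDl (q : subquotient) :
  {morph subquotient_scale^~ q : a b / a + b}.
Proof.
move=> a b; have [x ->] := subquotient_surj q.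
by rewrite !subquotient_pi_scale subquotient_pi_add scalerDl.
Qed.

HB.instance Definition _ := GRing.Zmodule_isLmodule.Build K subquotient
  subquotient_scaleA subquotient_scale1 subquotient_scaleDr subquotient_scaleDl.

Definition representative (q : subquotient) : V := val (repr q).

End SubQuotient.

Section Norms.
Context {R : realType}.

(* The library norm of a module over R[i] takes its values in R[i]. *)
Definition rnorm {V : normedZmodType R[i]} (x : V) : R := complex.Re `|x|.

Lemma rnormE (V : normedZmodType R[i]) (x : V) : `|x| = (rnorm x)%:C%C.
Proof.
have : 0 <= `|x| by [].
by rewrite /rnorm; case: `|x| => a b; rewrite lecE/= => /andP[/eqP -> _].
Qed.

Lemma rnorm_ge0 (V : normedZmodType R[i]) (x : V) : 0 <= rnorm x.
Proof. by rewrite -lecR -rnormE normr_ge0. Qed.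

Lemma rnorm0 (V : normedZmodType R[i]) : rnorm (0 : V) = 0.
Proof. by rewrite /rnorm normr0. Qed.

Lemma rnormD (V : normedZmodType R[i]) (x y : V) :
  rnorm (x + y) <= rnorm x + rnorm y.
Proof. by rewrite -lecR rmorphD/= -!rnormE ler_normD. Qed.

Lemma rnormZ (V : normedModType R[i]) (a : R[i]) (x : V) :
  rnorm (a *: x) = rnorm a * rnorm x.
Proof. by apply: complexI; rewrite rmorphM/= -!rnormE normrZ. Qed.

Context {V : lmodType R[i]}.
Implicit Types (S : set V) (N : V -> \bar R) (u : nat -> V).
Local Open Scope ereal_scope.

Definition cauchy_seq N u := forall e : R, (0 < e)%R ->
  exists n0, forall m n, (n0 <= m)%N -> (n0 <= n)%N -> N (u m - u n)%R < e%:E.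

Definition null_seq N u := forall e : R, (0 < e)%R ->
  exists n0, forall n, (n0 <= n)%N -> N (u n) < e%:E.

Record is_quasi_norm S N : Prop := IsQuasiNorm {
  quasi_norm_linear : S 0%R /\ forall (a : R[i]) x y,
    S x -> S y -> S (a *: x + y)%R ;
  quasi_norm_fin : forall x, S x -> 0 <= N x < +oo ;
  quasi_norm_eq0 : forall x, S x -> N x = 0 -> x = 0%R ;
  quasi_normZ : forall (a : R[i]) x, S x -> N (a *: x)%R = (rnorm a)%:E * N x ;
  quasi_normD : exists C : R, forall x y, S x -> S y ->
    N (x + y)%R <= C%:E * (N x + N y) }.

Definition is_norm S N := is_quasi_norm S N /\
  forall x y, S x -> S y -> N (x + y)%R <= N x + N y.

Definition seq_complete S N := forall u, (forall n, S (u n)) ->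
  cauchy_seq N u -> exists2 x, S x & null_seq N (fun n => u n - x)%R.

Definition quasi_banach S N := is_quasi_norm S N /\ seq_complete S N.

Definition banach S N := is_norm S N /\ seq_complete S N.

(* The value +oo and a nontrivial kernel are allowed, so that the spaces below
   can be built without any hypothesis on the frame. *)
Record pre_quasi_norm := PreQuasiNorm {
  pre_quasi_norm_fun :> V -> \bar R ;
  pre_quasi_norm_ge0 : forall x, 0 <= pre_quasi_norm_fun x ;
  pre_quasi_norm0 : pre_quasi_norm_fun 0%R = 0 ;
  pre_quasi_normD : forall a : R[i], exists2 C : R, (0 < C)%R & forall x y,
    pre_quasi_norm_fun (a *: x + y)%R <=
    C%:E * (pre_quasi_norm_fun x + pre_quasi_norm_fun y) }.

End Norms.
Arguments pre_quasi_norm {R} V.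

Section Completion.
Context {R : realType} {V : lmodType R[i]}.
Variables (S : subspace V) (N : pre_quasi_norm V).
Local Open Scope ereal_scope.

Definition cauchy_set : set (nat -> V) :=
  [set u | (forall n, subspace_set S (u n)) /\ cauchy_seq N u].

Definition null_set : set (nat -> V) := [set u | null_seq N u].

Lemma null_closed : null_set 0%R /\ forall (a : R[i]) (u v : nat -> V),
  null_set u -> null_set v -> null_set (a *: u + v)%R.
Proof.
split=> [e e0|a u v u0 v0 e e0].
  by exists 0%N => n _; rewrite [X in N X](_ : _ = 0%R)// pre_quasi_norm0 lte_fin.
have [C C0 HC] := pre_quasi_normD N a.
have e'0 : (0 < e / C / 2)%R by rewrite !divr_gt0.
have [m Hm] := u0 _ e'0; have [m' Hm'] := v0 _ e'0.
exists (maxn m m') => n; rewrite geq_max => /andP[mn m'n].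
apply: (le_lt_trans (HC _ _)).
have -> : e = (C * (e / C / 2 + e / C / 2))%R.
  by rewrite -splitr mulrC divfK// gt_eqF.
by rewrite EFinM lte_pmul2l// ?lte_fin// EFinD lteD// ?Hm ?Hm'.
Qed.

Lemma cauchy_closed : cauchy_set 0%R /\ forall (a : R[i]) (u v : nat -> V),
  cauchy_set u -> cauchy_set v -> cauchy_set (a *: u + v)%R.
Proof.
have [S0 SD] := subspace_closed S.
split=> [|a u v [uS u0] [vS v0]]; split.
- by move=> n; exact: S0.
- move=> e e0; exists 0%N => m n _ _; rewrite [X in N X](_ : _ = 0%R) ?subr0//.
  by rewrite pre_quasi_norm0 lte_fin.
- by move=> n; exact: SD.
move=> e e0; have [C C0 HC] := pre_quasi_normD N a.
have e'0 : (0 < e / C / 2)%R by rewrite !divr_gt0.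
have [k Hk] := u0 _ e'0; have [k' Hk'] := v0 _ e'0.
exists (maxn k k') => m n; rewrite !geq_max => /andP[km k'm] /andP[kn k'n].
rewrite [X in N X](_ : _ = a *: (u m - u n) + (v m - v n))%R; last first.
  by rewrite /= scalerBr opprD addrACA.
apply: (le_lt_trans (HC _ _)).
have -> : e = (C * (e / C / 2 + e / C / 2))%R.
  by rewrite -splitr mulrC divfK// gt_eqF.
by rewrite EFinM lte_pmul2l// ?lte_fin// EFinD lteD// ?Hk ?Hk'.
Qed.

(* Cauchy sequences of S modulo the sequences that tend to 0. *)
Definition completion :=
  subquotient (Subspace cauchy_closed) (Subspace null_closed).

HB.instance Definition _ := GRing.Lmodule.on completion.

Definition completion_norm (q : completion) : \bar R :=
  limn (fun n => N (representative q n)).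

End Completion.

Section BoundedOperators.
Context {R : realType} {H : completeNormedModType R[i]}.

Definition bounded_linear_set : set (H -> H) :=
  [set f | linear f /\ exists M : R, forall x, rnorm (f x) <= M * rnorm x].

Lemma bounded_linear_closed : bounded_linear_set 0 /\
  forall (a : R[i]) (f g : H -> H),
    bounded_linear_set f -> bounded_linear_set g -> bounded_linear_set (a *: f + g).
Proof.
split=> [|a f g [fl [M fM]] [gl [M' gM]]]; split.
- by move=> b x y; rewrite scaler0 addr0.
- by exists 0 => x; rewrite mul0r rnorm0.
- move=> b x y; rewrite !fctE fl gl !scalerDr !scalerA (mulrC a b).
  by rewrite -!scalerA addrACA.
- exists (rnorm a * M + M') => x; rewrite (le_trans (rnormD _ _))//.
  rewrite mulrDl lerD// rnormZ -mulrA ler_wpM2l// rnorm_ge0//.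
Qed.

Definition bop_space := Subspace bounded_linear_closed.
Definition bop := subspace_type bop_space.

HB.instance Definition _ := GRing.Lmodule.on bop.

Definition bop_fun (T : bop) : H -> H := val T.
Coercion bop_fun : bop >-> Funclass.

Lemma bopP (T : bop) : bounded_linear_set T.
Proof. exact/asboolP/(valP T). Qed.

HB.instance Definition _ (T : bop) :=
  GRing.isLinear.Build R[i] H H *:%R (bop_fun T) (bopP T).1.

Lemma bop_id_subproof : bounded_linear_set idfun.
Proof. by split=> [a x y//|]; exists 1 => x; rewrite mul1r. Qed.

Definition bop_id : bop := SubspaceType (@mem_subspace _ _ bop_space _ bop_id_subproof).

Lemma bop_comp_subproof (S T : bop) : bounded_linear_set (S \o T).
Proof.
have [M SM] := (bopP S).2; have [M' TM] := (bopP T).2; split=> [a x y/=|].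
  by rewrite !linearP.
exists (`|M| * M') => x /=; rewrite (le_trans (SM _))//.
rewrite (@le_trans _ _ (`|M| * rnorm (T x)))//.
  by rewrite ler_wpM2r ?rnorm_ge0// ler_norm.
by rewrite -mulrA ler_wpM2l.
Qed.

Definition bop_comp (S T : bop) : bop :=
  SubspaceType (@mem_subspace _ _ bop_space _ (bop_comp_subproof S T)).

Definition opnorm (T : bop) : \bar R :=
  ereal_sup [set (rnorm (T x))%:E | x in [set x | rnorm x <= 1]].

Definition is_adjoint (ip : {dot H for Num.conj}) (S T : bop) :=
  forall x y, ip (S x) y = ip x (T y).

(* The default value 0 is never used on a Hilbert space. *)
Definition adjoint (ip : {dot H for Num.conj}) (T : bop) : bop :=
  xget 0 [set S | is_adjoint ip T S].

End BoundedOperators.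
Arguments bop {R} H.

Record separable_hilbert {R : realType} {H : completeNormedModType R[i]}
    (ip : {dot H for Num.conj}) : Prop := SeparableHilbert {
  hilbert_normE : forall x : H, `|x| ^+ 2 = ip x x ;
  hilbert_separable : exists2 D : set H, countable D & dense D }.

Record weight (R : realType) (d : nat) := Weight {
  weight_fun :> 'rV[R]_d -> R ;
  weight_continuous : continuous weight_fun ;
  weight_gt0 : forall x, 0 < weight_fun x }.

Definition weight1 (R : realType) (d : nat) : weight R d :=
  @Weight R d (cst 1) (@cst_continuous _ _ _) (fun=> ltr01).

Section Sequences.
Context {R : realType} {d : nat} {X : set 'rV[R]_d}.
Context {H : completeNormedModType R[i]}.
Implicit Types (w : weight R d) (p : \bar R) (f g c : X -> H).
Local Open Scope ereal_scope.

Definition linfnorm w f : \bar R :=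
  ereal_sup (0 |` range (fun k : X => (rnorm (f k) * w (val k))%:E)).

(* The exponents 0 and +oo share the supremum norm; 0 is adjoined in
   [linfnorm] so that the supremum is not -oo when X is empty. Exponents that are
   negative or -oo also get it, but never occur. *)
Definition lpnorm w p f : \bar R :=
  if p is r%:E then
    if (0 < r)%R then
      (\esum_(k in [set: X]) ((rnorm (f k) * w (val k)) `^ r)%:E) `^ r^-1
    else linfnorm w f
  else linfnorm w f.

Definition l00 : set (X -> H) := [set f | finite_set [set k | f k != 0%R]].

(* The exponent 0 denotes the closure of l00 in the supremum norm. *)
Definition lp_space w p : set (X -> H) := [set f |
  if p == 0 then
    lpnorm w +oo f < +oo /\ forall e : R, (0 < e)%R ->
      exists2 g, l00 g & lpnorm w +oo (f - g)%R < e%:E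
  else lpnorm w p f < +oo].

Lemma rnormZD (a : R[i]) (x y : H) : (rnorm (a *: x + y) <=
  2 * Num.max (rnorm a) 1%R * Num.max (rnorm x) (rnorm y))%R.
Proof.
set m := Num.max (rnorm a) 1%R; set M := Num.max (rnorm x) (rnorm y).
have am : (rnorm a <= m)%R by rewrite le_max lexx.
have m1 : (1 <= m)%R by rewrite le_max lexx orbT.
have xM : (rnorm x <= M)%R by rewrite le_max lexx.
have yM : (rnorm y <= M)%R by rewrite le_max lexx orbT.
have M0 : (0 <= M)%R by rewrite (le_trans (rnorm_ge0 x)).
rewrite (le_trans (rnormD _ _))// rnormZ -mulrA mulr_natl mulr2n lerD//.
  by rewrite ler_pM// rnorm_ge0.
by rewrite (le_trans yM)// ler_peMl.
Qed.

Lemma linfnorm_ge0 w f : 0 <= linfnorm w f.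
Proof. by apply: ereal_sup_ubound; left. Qed.

Lemma linfnorm_ub w f k : (rnorm (f k) * w (val k))%:E <= linfnorm w f.
Proof. by apply: ereal_sup_ubound; right; exists k. Qed.

Lemma lpnorm_ge0 w p f : 0 <= lpnorm w p f.
Proof.
rewrite /lpnorm; case: p => [r| |]; try exact: linfnorm_ge0.
by case: ifP => _; [exact: poweR_ge0|exact: linfnorm_ge0].
Qed.

Lemma linfnorm0 w : linfnorm w 0%R = 0.
Proof.
apply/eqP; rewrite eq_le linfnorm_ge0 andbT.
apply: ge_ereal_sup => _ [->//|[k _ <-]].
by rewrite rnorm0 mul0r.
Qed.

Lemma lpnorm0 w p : lpnorm w p 0%R = 0.
Proof.
rewrite /lpnorm; case: p => [r| |]; try exact: linfnorm0.
case: ifP => [r0|_]; last exact: linfnorm0.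
rewrite esum1 ?poweR0r ?invr_neq0 ?gt_eqF// => k _.
by rewrite rnorm0 mul0r powR0// gt_eqF.
Qed.

Lemma linfnormZD w (a : R[i]) f g : linfnorm w (a *: f + g)%R <=
  (2 * Num.max (rnorm a) 1%R)%:E * (linfnorm w f + linfnorm w g).
Proof.
have m0 : (0 <= 2 * Num.max (rnorm a) 1 :> R)%R.
  by rewrite mulr_ge0// le_max ler01 orbT.
apply: ge_ereal_sup => _ [->|[k _ <-]].
  by rewrite mule_ge0 ?lee_fin// adde_ge0 ?linfnorm_ge0.
apply: (@le_trans _ _ ((2 * Num.max (rnorm a) 1%R *
    (rnorm (f k) * w (val k) + rnorm (g k) * w (val k)))%:E)).
  rewrite lee_fin (le_trans (ler_wpM2r (ltW (weight_gt0 w _)) (rnormZD a _ _)))//.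
  rewrite -[leLHS]mulrA ler_wpM2l// -mulrDl.
  apply: ler_wpM2r; first exact/ltW/weight_gt0.
  by rewrite ge_max lerDl lerDr !rnorm_ge0.
by rewrite EFinM lee_wpmul2l ?lee_fin// EFinD leeD// linfnorm_ub.
Qed.

Lemma powR_maxD (r x y : R) : (0 < r)%R -> (0 <= x)%R -> (0 <= y)%R ->
  (Num.max x y `^ r <= x `^ r + y `^ r)%R.
Proof.
move=> r0 x0 y0; case: (leP x y) => _; first by rewrite lerDr powR_ge0.
by rewrite lerDl powR_ge0.
Qed.

Lemma poweRD_le (r : R) (x y : \bar R) : (0 < r)%R -> 0 <= x -> 0 <= y ->
  (x + y) `^ r <= (2 `^ r)%:E * (x `^ r + y `^ r).
Proof.
move=> r0.
have p0 : (0 < 2 `^ r :> R)%R by rewrite powR_gt0.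
case: x => [x| |]//; case: y => [y| |]// x0 y0; last first.
- by rewrite addye// poweRyr ?gt_eqF// addye// gt0_muley.
- by rewrite addye// poweRyr ?gt_eqF// addye ?gt0_muley// -ltNye (lt_le_trans _ (poweR_ge0 _ _)).
- by rewrite addey// poweRyr ?gt_eqF// addey ?gt0_muley// -ltNye (lt_le_trans _ (poweR_ge0 _ _)).
rewrite !lee_fin in x0 y0.
rewrite -EFinD !poweR_EFin lee_fin.
have xy : (x + y <= 2 * Num.max x y)%R.
  by rewrite mulr_natl mulr2n lerD// le_max lexx ?orbT.
have M0 : (0 <= Num.max x y)%R by rewrite le_max x0.
apply: (@le_trans _ _ ((2 * Num.max x y) `^ r)%R).
  by apply: ge0_ler_powR; rewrite ?nnegrE ?addr_ge0 ?mulr_ge0 ?(ltW r0).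
by rewrite powRM// ler_pM2l// powR_maxD.
Qed.

Lemma le_esumZ (a : X -> \bar R) (r : R) : (0 <= r)%R -> (forall k, 0 <= a k) ->
  \esum_(k in [set: X]) (r%:E * a k) <= r%:E * \esum_(k in [set: X]) a k.
Proof.
move=> r0 a0; apply: ge_ereal_sup => _ [A [finA _] <-].
rewrite -ge0_mule_fsumr// lee_wpmul2l// -esum_fset//.
rewrite [leRHS](_ : _ = ereal_sup [set \sum_(k \in B) a k | B in fsets [set: X]])//.
by rewrite esum_fset//; apply: ereal_sup_ubound; exists A.
Qed.

Lemma lpnormZD w p (a : R[i]) : exists2 C : R, (0 < C)%R & forall f g,
  lpnorm w p (a *: f + g)%R <= C%:E * (lpnorm w p f + lpnorm w p g).
Proof.
have m0 : (0 < 2 * Num.max (rnorm a) 1%R :> R)%R.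
  by rewrite mulr_gt0// lt_max ltr01 orbT.
set m := (2 * Num.max (rnorm a) 1)%R in m0 *.
rewrite /lpnorm; case: p => [r| |]; try by exists m => // f g; exact: linfnormZD.
case: (ltP 0%R r) => r0; last by exists m => // f g; exact: linfnormZD.
exists ((m `^ r) `^ r^-1 * 2 `^ r^-1)%R; first by rewrite mulr_gt0 ?powR_gt0.
move=> f g; rewrite EFinM -muleA.
have w0 (k : X) := ltW (weight_gt0 w (val k)).
set S := fun h : X -> H => \esum_(k in [set: X]) ((rnorm (h k) * w (val k)) `^ r)%:E.
have S0 h : 0 <= S h by apply: esum_ge0 => k _; rewrite lee_fin powR_ge0.
rewrite -/(S f) -/(S g) -/(S (a *: f + g)%R).
have SD : S (a *: f + g)%R <= (m `^ r)%:E * (S f + S g).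
  rewrite -esumD; [|by move=> k _; rewrite lee_fin powR_ge0..].
  apply: le_trans (le_esumZ _ _); [|by rewrite powR_ge0|]; last first.
    by move=> k; rewrite adde_ge0 ?lee_fin ?powR_ge0.
  apply: le_esum => k _; rewrite -EFinD -EFinM lee_fin.
  have H1 : (rnorm ((a *: f + g)%R k) * w (val k) <=
      m * Num.max (rnorm (f k) * w (val k)) (rnorm (g k) * w (val k)))%R.
    by rewrite -maxr_pMl// mulrA ler_wpM2r// rnormZD.
  have M0 : (0 <= Num.max (rnorm (f k) * w (val k)) (rnorm (g k) * w (val k)))%R.
    by rewrite le_max mulr_ge0 ?rnorm_ge0.
  set M := Num.max _ _ in H1 M0.
  apply: (@le_trans _ _ ((m * M) `^ r)%R).
    apply: ge0_ler_powR => //; rewrite ?nnegrE ?(ltW r0)//.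
      by rewrite mulr_ge0 ?rnorm_ge0.
    by rewrite mulr_ge0 ?(ltW m0).
  rewrite [leLHS]powRM ?(ltW m0)// ler_pM2l ?powR_gt0//.
  by apply: powR_maxD => //; rewrite mulr_ge0 ?rnorm_ge0.
have ri0 : (0 < r^-1)%R by rewrite invr_gt0.
apply: (@le_trans _ _ (((m `^ r)%:E * (S f + S g)) `^ r^-1)).
  apply: gt0_ler_poweR => //; rewrite ?in_itv/= ?leey ?andbT ?S0//.
    exact: ltW.
  by rewrite mule_ge0 ?lee_fin ?powR_ge0 ?adde_ge0.
rewrite poweRM ?lee_fin ?powR_ge0 ?adde_ge0// poweR_EFin.
by rewrite lee_wpmul2l ?lee_fin ?powR_ge0// poweRD_le.
Qed.

End Sequences.

Section GFrames.
Context {R : realType} {d : nat} {X : set 'rV[R]_d}.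
Context {H : completeNormedModType R[i]}.
Variable ip : {dot H for Num.conj}.
Implicit Types T U Td : X -> bop H.

Definition energy T (x : H) : \bar R :=
  \esum_(k in [set: X]) ((rnorm (T k x)) ^+ 2)%:E.

Definition gbessel T := exists2 B : R, 0 < B &
  forall x, (energy T x <= (B * rnorm x ^+ 2)%:E)%E.

Definition gframe T := exists A B : R, [/\ 0 < A, A <= B & forall x,
  ((A * rnorm x ^+ 2)%:E <= energy T x <= (B * rnorm x ^+ 2)%:E)%E].

(* Sums over X are unconditional: limits along the net of finite subsets. *)
Definition has_sum {V : normedModType R[i]} (F : X -> V) (s : V) :=
  partial_sum F A @[A --> totally] --> s.

Definition dual_gframe T Td := gbessel Td /\ forall x,
  has_sum (fun k => adjoint ip (T k) (Td k x)) x /\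
  has_sum (fun k => adjoint ip (Td k) (T k x)) x.

Definition analysis Td (x : H) : X -> H := fun k => Td k x.

Definition synthesis T (c : X -> H) : H :=
  \sum_(k \in [set: X]) adjoint ip (T k) (c k).

End GFrames.

Section Matrices.
Context {R : realType} {d : nat} (X : set 'rV[R]_d).
Context {H : completeNormedModType R[i]}.
Variable ip : {dot H for Num.conj}.

Definition opmatrix := X -> X -> bop H.

Implicit Types A B C : opmatrix.

Definition mx_one : opmatrix := fun k l => if k == l then bop_id else 0.

Definition mx_star A : opmatrix := fun k l => adjoint ip (A l k).

Definition is_mx_prod A B C :=
  forall k l x, has_sum (fun m => A k m (B m l x)) (C k l x).

Definition mx_act A (f g : X -> H) :=
  forall k, has_sum (fun l => A k l (f l)) (g k).

Definition mx_bounded (w : weight R d) (p : \bar R) A := exists M : R,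
  forall f, lp_space w p f -> exists2 g, mx_act A f g &
    (lpnorm w p g <= M%:E * lpnorm w p f)%E.

Definition l2 : set (X -> H) := lp_space (weight1 R d) 2%:E.
Definition l2norm : (X -> H) -> \bar R := lpnorm (weight1 R d) 2%:E.

Definition l2_operator (S : (X -> H) -> X -> H) :=
  [/\ forall f, l2 f -> l2 (S f),
      forall (a : R[i]) f g, l2 f -> l2 g -> S (a *: f + g) = a *: S f + S g &
      exists M : R, forall f, l2 f -> (l2norm (S f) <= M%:E * l2norm f)%E].

(* Linearity and preservation of the unit hold for the matrix action itself. *)
Record l2_star_mono (AA : set opmatrix) : Prop := L2StarMono {
  l2_bounded : forall A, AA A -> mx_bounded (weight1 R d) 2%:E A ;
  l2_inj : forall A B, AA A -> AA B ->
    (forall f g, l2 f -> mx_act A f g -> mx_act B f g) -> A = B ;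
  l2_mul : forall A B C, AA A -> AA B -> AA C -> is_mx_prod A B C ->
    forall f g h, l2 f -> mx_act B f g -> mx_act A g h -> mx_act C f h ;
  l2_star : forall A, AA A -> forall f g f' g', l2 f -> l2 g ->
    mx_act A f f' -> mx_act (mx_star A) g g' ->
    forall s : R[i]^o, has_sum (fun k => ip (f' k) (g k) : R[i]^o) s ->
      has_sum (fun k => ip (f k) (g' k) : R[i]^o) s }.

(* [is_mx_prod] is a relation because the convergence of the entries, in the
   strong sense, is part of what membership in the algebra provides.
   Neither an isometric involution nor a unit of norm 1 is required. *)
Record spectral_algebra (AA : set opmatrix) (nA : opmatrix -> R) : Prop :=
SpectralAlgebra {
  spectral_banach : banach AA (fun A => (nA A)%:E) ;
  spectral_one : AA mx_one ;
  spectral_mul : forall A B, AA A -> AA B -> exists C,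
    [/\ AA C, is_mx_prod A B C & nA C <= nA A * nA B] ;
  spectral_star : forall A, AA A -> AA (mx_star A) ;
  spectral_l2 : l2_star_mono AA ;
  spectral_inv : forall A S, AA A -> l2_operator S ->
    (forall f, l2 f -> mx_act A (S f) f) ->
    (forall f g, l2 f -> mx_act A f g -> S g = f) ->
    exists2 B, AA B & forall f, l2 f -> mx_act B f (S f) ;
  spectral_solid : forall A B, AA A ->
    (forall k l, (opnorm (B k l) <= opnorm (A k l))%E) -> AA B /\ nA B <= nA A }.

Definition admissible (AA : set opmatrix) (p0 : R) (w : weight R d) :=
  forall A (p : \bar R), AA A -> (p0%:E < p)%E \/ p = 1%E -> mx_bounded w p A.

Definition algebra_similar (AA : set opmatrix) (U T : X -> bop H) :=
  AA (fun k l => bop_comp (U k) (adjoint ip (T l))).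

End Matrices.

Section Spaces.
Context {R : realType} {d : nat} {X : set 'rV[R]_d}.
Context {H : completeNormedModType R[i]}.
Variables (ip : {dot H for Num.conj}) (w : weight R d) (Td T : X -> bop H).

Definition H00_set : set H := [set synthesis ip T c | c in l00].

Lemma synthesisE (D : {fset X}) (c : X -> H) :
  (forall k, k \notin D -> c k = 0) ->
  synthesis ip T c = \sum_(k <- D) adjoint ip (T k) (c k).
Proof.
move=> c0; rewrite /synthesis (fsbigTE D)// => k /c0 ->.
by rewrite linear0.
Qed.

Lemma H00_closed : H00_set 0 /\ forall (a : R[i]) (x y : H),
  H00_set x -> H00_set y -> H00_set (a *: x + y).
Proof.
split=> [|a _ _ [c c0 <-] [c' c'0 <-]].
  exists 0; last by rewrite (@synthesisE fset0) ?big_nil.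
  by rewrite /l00/= (_ : mkset _ = set0)// -subset0 => k /=; rewrite eqxx.
have cc0 : finite_set ([set k | c k != 0] `|` [set k | c' k != 0]).
  by rewrite finite_setU.
have nD k : k \notin fset_set ([set k | c k != 0] `|` [set k | c' k != 0]) ->
    c k = 0 /\ c' k = 0.
  rewrite in_fset_set// notin_setE/= => /not_orP[].
  by move=> /negP/negPn/eqP -> /negP/negPn/eqP ->.
exists (a *: c + c').
  apply: sub_finite_set cc0 => k /=.
  have [ck|] := eqVneq (c k) 0; last by left.
  have [c'k|] := eqVneq (c' k) 0; last by right.
  by rewrite !fctE ck c'k scaler0 addr0 eqxx.
rewrite !(@synthesisE (fset_set ([set k | c k != 0] `|` [set k | c' k != 0]))).
- rewrite scaler_sumr -big_split/=; apply: eq_bigr => k _.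
  by rewrite -linearP.
- by move=> k /nD[].
- by move=> k /nD[].
- by move=> k /nD[ck c'k]; rewrite !fctE ck c'k scaler0 addr0.
Qed.

Definition H00 := Subspace H00_closed.

Lemma analysisE a x y : analysis Td (a *: x + y) =
  a *: analysis Td x + analysis Td y.
Proof. by apply/funext => k; rewrite /analysis linearP. Qed.

Lemma analysis0 : analysis Td 0 = 0.
Proof. by apply/funext => k; rewrite /analysis linear0. Qed.

Definition H00_norm (p : \bar R) (x : H) : \bar R := lpnorm w p (analysis Td x).

Lemma H00_normD p (a : R[i]) : exists2 C : R, 0 < C & forall x y,
  (H00_norm p (a *: x + y)%R <= C%:E * (H00_norm p x + H00_norm p y))%E.
Proof.
have [C C0 HC] := @lpnormZD R d X H w p a.
by exists C => // x y; rewrite /H00_norm analysisE; exact: HC.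
Qed.

Lemma H00_norm0 p : H00_norm p 0 = 0%E.
Proof. by rewrite /H00_norm analysis0 lpnorm0. Qed.

Definition H00_pre_quasi_norm p : pre_quasi_norm H :=
  PreQuasiNorm (fun x => lpnorm_ge0 w p (analysis Td x))
    (H00_norm0 p) (H00_normD p).

Definition Hp_completion p := completion H00 (H00_pre_quasi_norm p).

Definition sup_bounded (u : nat -> H) :=
  (ereal_sup (range (fun n => linfnorm w (analysis Td (u n)))) < +oo)%E.

Lemma sup_bounded0 : sup_bounded 0.
Proof.
apply: (@le_lt_trans _ _ 0%E); last exact: ltry.
apply: ge_ereal_sup => _ [n _ <-].
by rewrite (_ : (0 : nat -> H) n = 0)// analysis0 linfnorm0.
Qed.

Lemma sup_boundedD (a : R[i]) (u v : nat -> H) :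
  sup_bounded u -> sup_bounded v -> sup_bounded (a *: u + v).
Proof.
move=> ub vb.
apply: (@le_lt_trans _ _ ((2 * Num.max (rnorm a) 1)%:E *
  (ereal_sup (range (fun n => linfnorm w (analysis Td (u n)))) +
   ereal_sup (range (fun n => linfnorm w (analysis Td (v n))))))%E); last first.
  by rewrite lte_mul_pinfty ?lte_add_pinfty// lee_fin mulr_ge0// le_max ler01 orbT.
apply: ge_ereal_sup => _ [n _ <-].
rewrite (_ : (a *: u + v) n = a *: u n + v n)// analysisE.
apply: (le_trans (linfnormZD _ _ _ _)).
rewrite lee_wpmul2l ?lee_fin ?mulr_ge0 ?le_max ?ler01 ?orbT//.
by rewrite leeD//; apply: ereal_sup_ubound; exists n.
Qed.

Definition Hinf_set : set (nat -> H) := [set u |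
  (forall k, cvgn (fun n => Td k (u n))) /\ sup_bounded u].

(* Two sequences are (T^d, w)-equivalent when their difference is in this set. *)
Definition Hinf_null_set : set (nat -> H) := [set u |
  (forall k, Td k (u n) @[n --> \oo] --> (0 : H)) /\ sup_bounded u].

Lemma Hinf_closed : Hinf_set 0 /\ forall (a : R[i]) (u v : nat -> H),
  Hinf_set u -> Hinf_set v -> Hinf_set (a *: u + v).
Proof.
split=> [|a u v [uc ub] [vc vb]]; split.
- move=> k; rewrite [X in cvgn X](_ : _ = cst (0 : H)); last first.
    by apply/funext => n; rewrite linear0.
  exact: is_cvg_cst.
- exact: sup_bounded0.
- move=> k; rewrite [X in cvgn X](_ : _ =
      (fun n => a *: Td k (u n)) + (fun n => Td k (v n))); last first.
    by apply/funext => n; rewrite !fctE linearP.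
  have au := @is_cvgZl_tmp _ H nat \oo _ a _ (uc k).
  by apply: is_cvgD; [exact: au|exact: vc].
- exact: sup_boundedD.
Qed.

Lemma Hinf_null_closed : Hinf_null_set 0 /\
  forall (a : R[i]) (u v : nat -> H),
    Hinf_null_set u -> Hinf_null_set v -> Hinf_null_set (a *: u + v).
Proof.
split=> [|a u v [uc ub] [vc vb]]; split.
- move=> k; rewrite [X in X @ _ --> _](_ : _ = cst (0 : H)); last first.
    by apply/funext => n; rewrite linear0.
  exact: cvg_cst.
- exact: sup_bounded0.
- move=> k; rewrite [X in X @ _ --> _](_ : _ =
      (fun n => a *: Td k (u n)) + (fun n => Td k (v n))); last first.
    by apply/funext => n; rewrite !fctE linearP.
  rewrite [X in _ --> X](_ : _ = a *: 0 + 0); last by rewrite scaler0 addr0.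
  have au := @cvgZl_tmp _ H nat \oo _ a _ _ (uc k).
  by apply: cvgD; [exact: au|exact: vc].
- exact: sup_boundedD.
Qed.

Definition Hinf :=
  subquotient (Subspace Hinf_closed) (Subspace Hinf_null_closed).

Definition Hinf_analysis (q : Hinf) : X -> H :=
  fun k => limn (fun n => Td k (representative q n)).

(* The extension by density: the limit in the sequence space of the images of
   a Cauchy sequence that represents q. *)
Definition Hp_analysis p (q : Hp_completion p) : X -> H :=
  xget 0 [set c | lp_space w p c /\
    null_seq (lpnorm w p) (fun n => analysis Td (representative q n) - c)].

(* For +oo the classes of sequences, for the other exponents the completion of
   H00; -oo never occurs. *)
Definition Hpw (p : \bar R) : lmodType R[i] :=
  match p with
  | r%:E => Hp_completion r%:E
  | +oo%E => Hinf
  | -oo%E => Hp_completion -oo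
  end.

Definition Hpw_norm p : Hpw p -> \bar R :=
  match p return Hpw p -> \bar R with
  | r%:E => fun q => completion_norm q
  | +oo%E => fun q => linfnorm w (Hinf_analysis q)
  | -oo%E => fun q => completion_norm q
  end.

Definition Hpw_analysis p : Hpw p -> X -> H :=
  match p return Hpw p -> X -> H with
  | r%:E => @Hp_analysis r%:E
  | +oo%E => Hinf_analysis
  | -oo%E => @Hp_analysis -oo
  end.

Definition isometry_to_lp p (F : Hpw p -> X -> H) :=
  linear F /\ forall q, lp_space w p (F q) /\ lpnorm w p (F q) = Hpw_norm q.

End Spaces.
Arguments Hpw_norm {R d X H} ip w Td T p.
Arguments Hpw_analysis {R d X H} ip w Td T p.

(* Main.v *)
(* Analysis by T^d identifies every space H^p_w(T^d, T) with a closed subspace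
   of the complete space l^p_w, so everything reduces to l^p_w and to two facts
   about the Gram matrix G = [T^d_k T_l^*] in the spectral algebra: G maps l^00
   into l^p_w (for p = 0, through l^1_w), and analysis coefficients are fixed
   points of G by the reconstruction formula.
   For p = +oo the closed subspace is {c | G c = c}. Solidity puts the matrix
   |G_kl| id in the algebra, and its boundedness on l^oo_w says that
   sum_l |G_kl| / w(l) is finite for each k. Hence, by dominated convergence,
   the fixed points of G are closed under bounded pointwise limits; conversely
   a fixed point c is represented by the sequence D_T (c 1_{F_n}), F_n being an
   exhaustion of X by finite sets. *)

Require Import Defs.
From mathcomp Require Import all_boot all_order all_algebra finmap.
From mathcomp Require Import generic_quotient.
From mathcomp Require Import complex.
From mathcomp.analysis Require Import showcase.summability.
From mathcomp Require Import all_classical all_reals all_analysis.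
From mathcomp Require Import ring lra.

Set Implicit Arguments.
Unset Strict Implicit.
Unset Printing Implicit Defensive.

Import Order.TTheory GRing.Theory Num.Theory.
Import numFieldNormedType.Exports.

Local Open Scope classical_set_scope.
Local Open Scope ring_scope.
Local Open Scope quotient_scope.

#[local] Existing Instance totally_filter.

(** * Real-valued norms and convergence in modules over [R[i]] *)

Section RealNorm.
Context {R : realType} {V : normedModType R[i]}.
Implicit Types x y : V.

Lemma rnormN x : rnorm (- x) = rnorm x.
Proof. by rewrite /rnorm normrN. Qed.

Lemma rnormBC x y : rnorm (x - y) = rnorm (y - x).
Proof. by rewrite /rnorm distrC. Qed.

Lemma rnorm_eq0 x : rnorm x = 0 -> x = 0.
Proof. by move=> x0; apply/normr0_eq0; rewrite rnormE x0. Qed.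

Lemma rnorm_real (a : R) : rnorm (a%:C%C : R[i]) = `|a|.
Proof. by rewrite /rnorm normc_def/= expr0n/= addr0 sqrtr_sqr. Qed.

Lemma rnormB_dist x y : `|rnorm x - rnorm y| <= rnorm (x - y).
Proof.
rewrite ler_norml; apply/andP; split.
  rewrite lerBrDl -lerBrDr opprK addrC rnormBC.
  by rewrite -{1}(subrK x y) rnormD.
by rewrite lerBlDr -{1}(subrK y x) rnormD.
Qed.

Lemma rnorm_sum (I : Type) (s : seq I) (P : pred I) (F : I -> V) :
  rnorm (\sum_(i <- s | P i) F i) <= \sum_(i <- s | P i) rnorm (F i).
Proof.
elim/big_ind2 : _ => [|x a y b xa yb|//]; first by rewrite rnorm0.
by rewrite (le_trans (rnormD _ _))// lerD.
Qed.

(** The library criterion ranges over positive tolerances in [R[i]]. Such a tolerance has zero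
    imaginary part, so real ones suffice. *)
Lemma cvg_rnormP {T : Type} {F : set_system T} {FF : Filter F}
    (u : T -> V) (l : V) :
  u @ F --> l <-> forall e : R, 0 < e -> \forall t \near F, rnorm (l - u t) < e.
Proof.
split=> [/cvgrPdist_lt ul e e0|ul].
  have e0' : 0 < e%:C%C by rewrite ltcR.
  by move: (ul _ e0'); apply: filterS => t; rewrite rnormE ltcR.
apply/cvgrPdist_lt => -[e e'] ee0; have := ee0.
rewrite ltcE/= => /andP[/eqP -> e0].
by move: (ul _ e0); apply: filterS => t; rewrite rnormE ltcR.
Qed.

Lemma cvg_rnorm {T : Type} {F : set_system T} {FF : Filter F}
    (u : T -> V) (l : V) :
  u @ F --> l -> (fun t => rnorm (u t)) @ F --> rnorm l.
Proof.
move=> /cvg_rnormP ul; apply/cvgrPdist_lt => e e0.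
move: (ul _ e0); apply: filterS => t; exact: le_lt_trans (rnormB_dist _ _).
Qed.

End RealNorm.

Lemma rnorm_cauchy_cvg {R : realType} {V : completeNormedModType R[i]}
    (u : nat -> V) :
  (forall e : R, 0 < e -> exists n0, forall m n, (n0 <= m)%N -> (n0 <= n)%N ->
    rnorm (u m - u n) < e) -> cvgn u.
Proof.
move=> uC; apply/cauchy_cvgP/cauchy_exP => -[e e'] ee0; have := ee0.
rewrite ltcE/= => /andP[/eqP -> e0].
have [n0 Hn0] := uC _ e0.
exists (u n0); exists n0 => // n n0n.
by rewrite -ball_normE/= rnormE ltcR; exact: Hn0.
Qed.

(** * Inequalities and limits for real powers *)

Lemma powR_subadditive {R : realType} (r x y : R) : 0 < r -> r <= 1 ->
  0 <= x -> 0 <= y -> (x + y) `^ r <= x `^ r + y `^ r.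
Proof.
move=> r0 r1 x0 y0.
have [xy0|xyN0] := eqVneq (x + y) 0.
  by rewrite xy0 powR0 ?gt_eqF// addr_ge0 ?powR_ge0.
have xy0 : 0 < x + y by rewrite lt_neqAle eq_sym xyN0 addr_ge0.
(* For t = z / (x + y) in [0, 1] one has t <= t^r; the fractions for z = x and z = y add up to 1. *)
have H z : 0 <= z -> z <= x + y -> z / (x + y) * (x + y) `^ r <= z `^ r.
  move=> z0 zxy; have [->|zN0] := eqVneq z 0; first by rewrite !mul0r powR_ge0.
  have zgt0 : 0 < z by rewrite lt_neqAle eq_sym zN0.
  rewrite -[in leRHS](divfK xyN0 z) powRM ?divr_ge0 ?(ltW xy0)//.
  rewrite ler_wpM2r ?powR_ge0// ger1_powR// divr_gt0//=.
  by rewrite ler_pdivrMr// mul1r.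
apply: le_trans (lerD (H x x0 _) (H y y0 _)); rewrite ?lerDl ?lerDr//.
by rewrite -!mulrDl divff// mul1r.
Qed.

(** Convexity of t^r at x/a and y/b with weights a/(a+b) and b/(a+b), scaled by (a+b)^r. When a and
    b are the norms of two sequences, summing over coordinates gives Minkowski's inequality without
    Hölder's. *)
Lemma powR_convex_sum {R : realType} (r a b x y : R) : 1 <= r ->
  0 < a -> 0 < b -> 0 <= x -> 0 <= y ->
  (x + y) `^ r <=
  (a + b) `^ r * (a / (a + b) * (x / a) `^ r + b / (a + b) * (y / b) `^ r).
Proof.
move=> r1 a0 b0 x0 y0; have ab0 : 0 < a + b by rewrite addr_gt0.
have r0 : 0 <= r by rewrite (le_trans ler01).
have t01 : 0 <= a / (a + b) <= 1.
  rewrite divr_ge0 ?(ltW a0) ?(ltW ab0)//= ler_pdivrMr// mul1r lerDl.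
  exact: ltW.
have : (a / (a + b) * (x / a) + (1 - a / (a + b)) * (y / b)) `^ r <=
    a / (a + b) * (x / a) `^ r + (1 - a / (a + b)) * (y / b) `^ r.
  have := @convex_powR R r r1
    (@Itv01 R (a / (a + b)) (andP t01).1 (andP t01).2) (x / a) (y / b).
  rewrite !inE/= !in_itv/= !andbT !divr_ge0 ?(ltW a0) ?(ltW b0)//.
  by apply.
have -> : 1 - a / (a + b) = b / (a + b).
  by rewrite -[X in X - _](divff (lt0r_neq0 ab0)) -mulrBl addrAC subrr add0r.
move=> H.
have -> : x + y = (a + b) * (a / (a + b) * (x / a) + b / (a + b) * (y / b)).
  by field; rewrite !gt_eqF.
rewrite powRM ?(ltW ab0)//; last first.
  by rewrite addr_ge0// mulr_ge0 ?divr_ge0 ?(ltW a0) ?(ltW b0) ?(ltW ab0).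
by rewrite ler_wpM2l ?powR_ge0.
Qed.

(** Continuity comes from derivability on the open half-line, hence the positive limit; limits equal
    to 0 are treated separately where they occur. *)
Lemma powR_cvg {R : realType} {T : Type} {F : set_system T} {FF : Filter F}
    (r l : R) (u : T -> R) : 0 < l -> u @ F --> l ->
  (fun t => u t `^ r) @ F --> l `^ r.
Proof.
move=> l0 ul.
have c : {for l, continuous (fun x : R => x `^ r)}.
  apply/differentiable_continuous/derivable1_diffP.
  by apply: derivable_powR; rewrite in_itv/= l0.
exact: cvg_comp ul c.
Qed.

Lemma cvg_sum_seq {K : numFieldType} {V : normedModType K} {T I : Type}
    {F : set_system T} {FF : Filter F} (s : seq I) (u : T -> I -> V)
    (l : I -> V) :
  (forall i, u t i @[t --> F] --> l i) ->
  \sum_(i <- s) u t i @[t --> F] --> \sum_(i <- s) l i.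
Proof.
move=> ul; elim: s => [|i s IHs].
  rewrite big_nil; under eq_fun do rewrite big_nil; exact: cvg_cst.
rewrite big_cons; under eq_fun do rewrite big_cons; exact: cvgD.
Qed.

Lemma ge0_le_poweR {R : realType} (r : R) (x y : \bar R) :
  0 <= r -> (0 <= x -> x <= y -> x `^ r <= y `^ r)%E.
Proof.
move=> r0 x0 xy; apply: gt0_ler_poweR => //; rewrite in_itv/= leey andbT//.
exact: le_trans xy.
Qed.

(** * Norm inequalities in the weighted sequence spaces *)

Section LpSpaces.
Context {R : realType} {d : nat} {X : set 'rV[R]_d}.
Context {H : completeNormedModType R[i]}.
Variable w : weight R d.
Implicit Types (p : \bar R) (f g c : X -> H) (k : X) (r B : R).

Definition wnorm f k : R := rnorm (f k) * w (val k).

Let w0 k : 0 < w (val k). Proof. exact: weight_gt0. Qed.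

Lemma wnorm_ge0 f k : 0 <= wnorm f k.
Proof. by rewrite mulr_ge0 ?rnorm_ge0// ltW. Qed.

Lemma wnormD f g k : wnorm (f + g) k <= wnorm f k + wnorm g k.
Proof. by rewrite -mulrDl ler_wpM2r ?rnormD// ltW. Qed.

Lemma wnorm_eq0 f k : wnorm f k = 0 -> f k = 0.
Proof.
by move/eqP; rewrite mulf_eq0 (gt_eqF (w0 k)) orbF => /eqP/rnorm_eq0.
Qed.

Lemma cvg_wnorm (u : nat -> X -> H) f k :
  u n k @[n --> \oo] --> f k -> wnorm (u n) k @[n --> \oo] --> wnorm f k.
Proof. by move=> uf; apply: cvgMl; exact: cvg_rnorm. Qed.

Lemma linfnorm_leP f B : 0 <= B ->
  (linfnorm w f <= B%:E)%E <-> forall k, wnorm f k <= B.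
Proof.
move=> B0; split=> [fB k|fB].
  by rewrite -lee_fin (le_trans _ fB)//; exact: linfnorm_ub.
by apply: ge_ereal_sup => _ [->|[k _ <-]]; rewrite lee_fin//; exact: fB.
Qed.

(** The infinite sum is a supremum over finite sets, and t^r is increasing with inverse t^(1/r). All
    later estimates for finite exponents thus become estimates of finite real sums. *)
Lemma lpnorm_leP r f B : 0 < r -> 0 <= B ->
  (lpnorm w r%:E f <= B%:E)%E <->
  forall A : {fset X}, \sum_(k <- A) wnorm f k `^ r <= B `^ r.
Proof.
move=> r0 B0; rewrite /lpnorm r0.
set S := (\esum_(k in [set: X]) _)%E.
have S0 : (0 <= S)%E by apply: esum_ge0 => k _; rewrite lee_fin powR_ge0.
have SP : (S <= (B `^ r)%:E)%E <->
    forall A : {fset X}, \sum_(k <- A) wnorm f k `^ r <= B `^ r.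
  split=> [SB A|SB].
    rewrite -lee_fin (le_trans _ SB)//; apply: ereal_sup_ubound.
    exists [set` A]; first by split=> [|//]; exact: finite_fset.
    rewrite fsbig_finite//= set_fsetK/=.
    by rewrite sumEFin.
  apply: ge_ereal_sup => _ [A [finA _] <-].
  rewrite fsbig_finite//= sumEFin lee_fin.
  exact: SB.
rewrite -SP; split=> [SB|SB].
  have := ge0_le_poweR (ltW r0) (poweR_ge0 _ _) SB.
  by rewrite -poweRrM mulVf ?gt_eqF// poweRe1// poweR_EFin.
have ri0 : 0 < r^-1 by rewrite invr_gt0.
have := ge0_le_poweR (ltW ri0) S0 SB.
by rewrite poweR_EFin -powRrM mulfV ?gt_eqF// powRr1.
Qed.

(** Two cases cover every exponent, 0 and [+oo] being handled together. *)
Lemma lpnorm_case p : (exists2 r, 0 < r & p = r%:E) \/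
  forall f, lpnorm w p f = linfnorm w f.
Proof.
case: p => [r| |]; [|by right..].
case: (ltP 0 r) => r0; first by left; exists r.
by right=> f; rewrite /lpnorm ltNge r0.
Qed.

(** Tests [lpnorm_leP] on a one-point set. It makes the coordinates continuous for every
    exponent. *)
Lemma wnorm_le_lpnorm p f k : ((wnorm f k)%:E <= lpnorm w p f)%E.
Proof.
have [[r r0 ->]|->] := lpnorm_case p; last exact: linfnorm_ub.
have := lpnorm_ge0 w r%:E f.
have := @lpnorm_leP r f (fine (lpnorm w r%:E f)) r0.
case: (lpnorm _ _ _) => [b| |]//; last by move=> _ _; rewrite leey.
rewrite !lee_fin => fb b0; have /(_ [fset k]%fset) := (fb b0).1 (lexx _) => /=.
rewrite big_seq_fset1 => H1.
have := @ge0_ler_powR R r^-1; rewrite invr_ge0 => /(_ (ltW r0)).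
move=> /(_ (wnorm f k `^ r) (b `^ r)); rewrite !nnegrE !powR_ge0.
move=> /(_ isT isT H1).
by rewrite -!powRrM mulfV ?gt_eqF// !powRr1// wnorm_ge0.
Qed.

Lemma lpnorm_eq0 p f : lpnorm w p f = 0%E -> f = 0.
Proof.
move=> f0; apply/funext => k; apply/wnorm_eq0/eqP.
rewrite eq_le wnorm_ge0 andbT.
by have := wnorm_le_lpnorm p f k; rewrite f0 lee_fin.
Qed.

Lemma le_lpnorm p f g : (forall k, wnorm f k <= wnorm g k) ->
  (lpnorm w p f <= lpnorm w p g)%E.
Proof.
move=> fg; have := lpnorm_ge0 w p g.
case E : (lpnorm w p g) => [b| |]//; last by move=> _; rewrite leey.
rewrite lee_fin => b0.
have [[r r0 pr]|pE] := lpnorm_case p; last first.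
  rewrite pE; apply/linfnorm_leP => // k; rewrite (le_trans (fg k))//.
  by have : (linfnorm w g <= b%:E)%E; [rewrite -pE E|move/linfnorm_leP; exact].
rewrite pr in E *; apply/lpnorm_leP => // A.
have : (lpnorm w r%:E g <= b%:E)%E by rewrite E.
move=> /lpnorm_leP => /(_ r0 b0 A); apply: le_trans; apply: ler_sum => k _.
by apply: ge0_ler_powR; rewrite ?nnegrE ?wnorm_ge0// ltW.
Qed.

Lemma lpnormN p f : lpnorm w p (- f) = lpnorm w p f.
Proof.
by apply/eqP; rewrite eq_le !le_lpnorm// => k;
  rewrite /wnorm fctE rnormN.
Qed.

Lemma lpnormBC p f g : lpnorm w p (f - g) = lpnorm w p (g - f).
Proof. by rewrite -opprB lpnormN. Qed.

Lemma lpnormZ_le p (a : R[i]) f :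
  (lpnorm w p (a *: f)%R <= (rnorm a)%:E * lpnorm w p f)%E.
Proof.
have [a0|aN0] := eqVneq (rnorm a) 0.
  rewrite a0 mul0e (_ : a *: f = 0) ?lpnorm0// .
  by rewrite (@rnorm_eq0 R R[i]^o _ a0) scale0r.
have a0 : 0 < rnorm a by rewrite lt_neqAle eq_sym aN0 rnorm_ge0.
have := lpnorm_ge0 w p f.
case E : (lpnorm w p f) => [b| |]//; last first.
  by move=> _; rewrite gt0_muley ?leey// lte_fin.
rewrite lee_fin => b0; rewrite -EFinM.
have ab0 : 0 <= rnorm a * b by rewrite mulr_ge0// ltW.
have aw k : wnorm (a *: f) k = rnorm a * wnorm f k.
  by rewrite /wnorm fctE rnormZ mulrA.
have [[r r0 pr]|pE] := lpnorm_case p; last first.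
  rewrite pE; apply/linfnorm_leP => // k; rewrite aw ler_pM2l//.
  by rewrite -lee_fin -E wnorm_le_lpnorm.
rewrite pr in E *; apply/lpnorm_leP => // A.
have : (lpnorm w r%:E f <= b%:E)%E by rewrite E.
move=> /lpnorm_leP => /(_ r0 b0 A) fA.
under eq_bigr do rewrite aw powRM ?wnorm_ge0 ?(ltW a0)//.
by rewrite -mulr_sumr powRM ?(ltW a0)// ler_wpM2l ?powR_ge0.
Qed.

Lemma lpnormZ p (a : R[i]) f :
  lpnorm w p (a *: f) = ((rnorm a)%:E * lpnorm w p f)%E.
Proof.
apply/eqP; rewrite eq_le lpnormZ_le/=.
have [->|aN0] := eqVneq a 0; first by rewrite rnorm0 mul0e lpnorm_ge0.
have ra0 : 0 < rnorm a.
  rewrite lt_neqAle rnorm_ge0 andbT eq_sym; apply: contra_neq aN0.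
  exact: (@rnorm_eq0 R R[i]^o).
(* The reverse inequality is [lpnormZ_le] for the scalar a^-1 and the sequence a f. *)
have {1}-> : f = a^-1 *: (a *: f) by rewrite scalerA mulVf// scale1r.
apply: le_trans (lee_wpmul2l _ (lpnormZ_le _ _ _)) _.
  by rewrite lee_fin ltW.
have -> : rnorm a^-1 = (rnorm a)^-1.
  apply: (mulfI (lt0r_neq0 ra0)); rewrite divff ?gt_eqF//.
  have <- := @rnormZ R R[i]^o a a^-1.
  by rewrite [_ *: _]divff// /rnorm normr1.
by rewrite muleA -EFinM divff ?gt_eqF// mul1e.
Qed.

(* For r < 1 only the r-th power of the quasi-norm is subadditive; this is what
   makes the quasi-norm continuous. *)
Lemma lpnormD_le1 r f g : 0 < r -> r <= 1 -> (lpnorm w r%:E (f + g)%R `^ r <=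
  lpnorm w r%:E f `^ r + lpnorm w r%:E g `^ r)%E.
Proof.
move=> r0 r1.
have := lpnorm_ge0 w r%:E f; have := lpnorm_ge0 w r%:E g.
case F : (lpnorm w r%:E f) => [a| |]//; last first.
  move=> _ *; rewrite (poweRyr (lt0r_neq0 r0)).
  by rewrite addye ?leey// -ltNye (lt_le_trans _ (poweR_ge0 _ _)).
case G : (lpnorm w r%:E g) => [b| |]//; last first.
  move=> _ *; rewrite (poweRyr (lt0r_neq0 r0)).
  by rewrite addey ?leey// -ltNye (lt_le_trans _ (poweR_ge0 _ _)).
rewrite !lee_fin => b0 a0.
have := (lpnorm_leP f r0 a0).1; rewrite F => /(_ (lexx _)) fA.
have := (lpnorm_leP g r0 b0).1; rewrite G => /(_ (lexx _)) gA.
(* The number whose r-th power is the desired bound, as [lpnorm_leP] expects. *)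
set c := (a `^ r + b `^ r) `^ r^-1.
have cr : c `^ r = a `^ r + b `^ r.
  by rewrite -powRrM mulVf ?gt_eqF// powRr1// addr_ge0// powR_ge0.
have : (lpnorm w r%:E (f + g)%R <= c%:E)%E.
  apply/lpnorm_leP; rewrite ?powR_ge0// => A; rewrite cr.
  apply: le_trans (lerD (fA A) (gA A)); rewrite -big_split/=.
  apply: ler_sum => k _.
  apply: le_trans (powR_subadditive _ _ (wnorm_ge0 _ _) (wnorm_ge0 _ _)) => //.
  by apply: ge0_ler_powR; rewrite ?nnegrE ?addr_ge0 ?wnorm_ge0 ?wnormD// ltW.
move=> /(ge0_le_poweR (ltW r0) (lpnorm_ge0 _ _ _)).
by rewrite !poweR_EFin cr EFinD.
Qed.

Lemma lpnormD_le p f g : (1 <= p)%E \/ p = 0%E ->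
  (lpnorm w p (f + g)%R <= lpnorm w p f + lpnorm w p g)%E.
Proof.
move=> p1.
have := lpnorm_ge0 w p f; have := lpnorm_ge0 w p g.
case F : (lpnorm w p f) => [a| |]//; last first.
  by case: (lpnorm w p g) => [b| |]//= _ _; rewrite leey.
case G : (lpnorm w p g) => [b| |]//; last by move=> _ _; rewrite addey// leey.
rewrite !lee_fin => b0 a0.
have [[r r0 pr]|pE] := lpnorm_case p; last first.
  rewrite pE; apply/linfnorm_leP; first by rewrite addr_ge0.
  move=> k; rewrite (le_trans (wnormD _ _ _))// lerD// -lee_fin -?F -?G.
    exact: wnorm_le_lpnorm.
  exact: wnorm_le_lpnorm.
have r1 : 1 <= r.
  case: p1 => [|p0]; first by rewrite pr lee_fin.
  by move: p0 r0; rewrite pr => -[->]; rewrite ltxx.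
rewrite {p p1}pr in F G *.
apply/lee_addgt0Pr => e e0.
pose a' := a + e / 2; pose b' := b + e / 2.
have a'0 : 0 < a' by rewrite /a'; lra.
have b'0 : 0 < b' by rewrite /b'; lra.
have fa' : (lpnorm w r%:E f <= a'%:E)%E.
  by rewrite F lee_fin lerDl; apply: divr_ge0 => //; exact: ltW.
have gb' : (lpnorm w r%:E g <= b'%:E)%E.
  by rewrite G lee_fin lerDl; apply: divr_ge0 => //; exact: ltW.
(* Convexity of t^r at the point [a'/(a'+b') (f/a') + b'/(a'+b') (g/b')]; the
   e/2 keeps a' and b' positive. *)
rewrite -!EFinD (_ : a + b + e = a' + b'); last by rewrite /a' /b'; field.
clearbody a' b'.
apply/lpnorm_leP; rewrite ?addr_ge0 ?(ltW a'0) ?(ltW b'0)// => A.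
move/(lpnorm_leP _ r0 (ltW a'0)) : fa' => /(_ A) fA.
move/(lpnorm_leP _ r0 (ltW b'0)) : gb' => /(_ A) gA.
have key k : wnorm (f + g) k `^ r <= (a' + b') `^ r *
    (a' / (a' + b') * (a'^-1 `^ r * wnorm f k `^ r) +
     b' / (a' + b') * (b'^-1 `^ r * wnorm g k `^ r)).
  have a'i : 0 <= a'^-1 by rewrite invr_ge0 ltW.
  have b'i : 0 <= b'^-1 by rewrite invr_ge0 ltW.
  rewrite -!powRM ?wnorm_ge0// !(mulrC _^-1).
  apply: le_trans (powR_convex_sum r1 a'0 b'0 (wnorm_ge0 _ _) (wnorm_ge0 _ _)).
  apply: ge0_ler_powR; rewrite ?nnegrE ?addr_ge0 ?wnorm_ge0 ?wnormD//.
  exact: ltW.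
apply: le_trans (ler_sum _ (fun k _ => key k)) _.
rewrite -mulr_sumr big_split/= -!mulr_sumr.
rewrite -[leRHS]mulr1 ler_wpM2l ?powR_ge0//.
have ci x : 0 < x -> x^-1 `^ r * x `^ r = 1.
  move=> x0; rewrite -powRM ?invr_ge0 ?(ltW x0)// mulVf ?gt_eqF// powR1//.
(* With 1 written as the sum of the two weights, [fA] and [gA] bound each summand separately. *)
have -> : 1 = a' / (a' + b') * (a'^-1 `^ r * a' `^ r) +
              b' / (a' + b') * (b'^-1 `^ r * b' `^ r).
  by rewrite !ci//; field; rewrite gt_eqF// addr_gt0.
have ab0 : 0 < a' + b' by rewrite addr_gt0.
by apply: lerD; apply: ler_wpM2l; rewrite ?divr_ge0 ?(ltW a'0) ?(ltW b'0)
  ?(ltW ab0)//; apply: ler_wpM2l; rewrite ?powR_ge0.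
Qed.

(** A Fatou property: a bound on every finite sum, or on every coordinate, survives pointwise
    limits. *)
Lemma lpnorm_lsc p (u : nat -> X -> H) f B : 0 <= B ->
  (forall k, u n k @[n --> \oo] --> f k) ->
  (forall n, (lpnorm w p (u n) <= B%:E)%E) -> (lpnorm w p f <= B%:E)%E.
Proof.
move=> B0 uf uB; have uf' k := cvg_wnorm (uf k).
have [[r r0 pr]|pE] := lpnorm_case p; last first.
  rewrite pE; apply/linfnorm_leP => // k.
  apply: (cvgr_to_le (uf' k)); near=> n.
  by rewrite -lee_fin (le_trans (wnorm_le_lpnorm p _ _)).
rewrite pr in uB *; apply/lpnorm_leP => // A.
have ufr k : wnorm (u n) k `^ r @[n --> \oo] --> wnorm f k `^ r.
  (* [powR_cvg] needs a positive limit; at 0 the tolerance e^(1/r) is used directly. *)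
  have [f0|fN0] := eqVneq (wnorm f k) 0; last first.
    by apply: powR_cvg => //; rewrite lt_neqAle eq_sym fN0 wnorm_ge0.
  rewrite f0 powR0 ?gt_eqF//; apply/cvgrPdist_lt => e e0.
  have e'0 : 0 < e `^ r^-1 by rewrite powR_gt0.
  move: (uf' k) => /cvgrPdist_lt /(_ _ e'0).
  apply: filterS => n; rewrite f0 !sub0r !normrN.
  rewrite !ger0_norm ?powR_ge0 ?wnorm_ge0// => H1.
  rewrite [ltRHS](_ : _ = (e `^ r^-1) `^ r); last first.
    by rewrite -powRrM mulVf ?gt_eqF// powRr1// ltW.
  by apply: gt0_ltr_powR; rewrite ?nnegrE ?wnorm_ge0 ?powR_ge0.
have : \sum_(k <- A) wnorm (u n) k `^ r @[n --> \oo] -->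
    \sum_(k <- A) wnorm f k `^ r by exact: cvg_sum_seq.
move=> /cvgr_to_le; apply; near=> n.
exact: (lpnorm_leP _ r0 B0).1 (uB n) A.
Unshelve. all: by end_near. Qed.

End LpSpaces.

(** * Continuity of the norm and completeness of the sequence spaces *)

Section LpComplete.
Context {R : realType} {d : nat} {X : set 'rV[R]_d}.
Context {H : completeNormedModType R[i]}.
Variable w : weight R d.
Implicit Types (p : \bar R) (f g c : X -> H) (k : X) (r B : R).

Lemma lpnorm_lty p (a : R[i]) f g : (lpnorm w p f < +oo)%E ->
  (lpnorm w p g < +oo)%E -> (lpnorm w p (a *: f + g)%R < +oo)%E.
Proof.
move=> fy gy; have [C C0 HC] := @lpnormZD _ _ X H w p a.
apply: le_lt_trans (HC f g) _.
by rewrite lte_mul_pinfty ?lte_add_pinfty// lee_fin ltW.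
Qed.

Lemma lpnormB_lty p f g : (lpnorm w p f < +oo)%E ->
  (lpnorm w p g < +oo)%E -> (lpnorm w p (f - g)%R < +oo)%E.
Proof.
move=> fy gy; rewrite -(scale1r f); apply: lpnorm_lty => //.
by rewrite lpnormN.
Qed.

Lemma lpnorm0E f : lpnorm w 0%E f = linfnorm w f.
Proof. by rewrite /lpnorm/= ltxx. Qed.

Lemma lp_space_lty p f : lp_space w p f -> (lpnorm w p f < +oo)%E.
Proof.
by rewrite /lp_space/=; case: eqVneq => [->|//] []; rewrite lpnorm0E.
Qed.

Lemma le_lpnorm_dist p f g : (1 <= p)%E \/ p = 0%E ->
  (lpnorm w p f <= lpnorm w p g + lpnorm w p (f - g)%R)%E.
Proof.
move=> p1; rewrite -{1}(subrK g f) addeC.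
exact: lpnormD_le.
Qed.

Lemma le_lpnorm_dist_le1 r f g : 0 < r -> r <= 1 ->
  (lpnorm w r%:E f `^ r <=
   lpnorm w r%:E g `^ r + lpnorm w r%:E (f - g)%R `^ r)%E.
Proof.
move=> r0 r1; rewrite -{1}(subrK g f) addeC.
exact: lpnormD_le1.
Qed.

(** A quasi-norm need not be continuous in general. Here either the norm itself or, for exponents
    below 1, its r-th power satisfies a reverse triangle inequality. *)
Lemma lpnorm_cvg p (u : nat -> X -> H) c : (0 <= p)%E ->
  (lpnorm w p c < +oo)%E -> null_seq (lpnorm w p) (fun n => u n - c) ->
  lpnorm w p (u n) @[n --> \oo] --> lpnorm w p c.
Proof.
move=> p0 cy uc.
have fin f : (lpnorm w p f < +oo)%E -> lpnorm w p f \is a fin_num.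
  by move=> fy; rewrite ge0_fin_numE ?lpnorm_ge0.
have ucfin : \forall n \near \oo, lpnorm w p (u n - c) \is a fin_num.
  have [n0 Hn0] := uc _ ltr01; exists n0 => // n /= n0n; apply: fin.
  exact: lt_trans (Hn0 _ n0n) (ltry _).
have ufin : \forall n \near \oo, lpnorm w p (u n) \is a fin_num.
  move: ucfin; apply: filterS => n; rewrite ge0_fin_numE ?lpnorm_ge0// => ucn.
  by apply: fin; rewrite -(subrK c (u n)) -(scale1r (u n - c)) lpnorm_lty.
rewrite -(fineK (fin _ cy)); apply/fine_cvgP; split=> //.
have dist0 (e : R) : 0 < e ->
    \forall n \near \oo, fine (lpnorm w p (u n - c)) < e.
  move=> e0; have [n0 Hn0] := uc _ e0.
  near=> n; rewrite -lte_fin fineK; last by near: n.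
  by apply: Hn0; near: n; exists n0.
have x0 f : 0 <= fine (lpnorm w p f) by rewrite fine_ge0 ?lpnorm_ge0.
have [p1|] := pselect ((1 <= p)%E \/ p = 0%E).
  apply/cvgrPdist_lt => e e0; near=> n.
  have un : lpnorm w p (u n) \is a fin_num by near: n.
  have ucn : lpnorm w p (u n - c) \is a fin_num by near: n.
  have dn : fine (lpnorm w p (u n - c)) < e by near: n; exact: dist0.
  apply: le_lt_trans dn.
  have := le_lpnorm_dist (u n) c p1; have := le_lpnorm_dist c (u n) p1.
  rewrite (lpnormBC _ _ c) -(fineK (fin _ cy)) -(fineK un) -(fineK ucn).
  rewrite -!EFinD !lee_fin /= ler_norml => ? ?.
  by apply/andP; split; lra.
(* Now 0 < p < 1: convergence is proved for the r-th powers, and the root is taken at the end. *)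
move=> /not_orP[/negP p1 /eqP pN0].
have {p0 pN0} p0 : (0 < p)%E by rewrite lt_neqAle eq_sym p0 pN0.
case: p p0 p1 cy uc fin ucfin ufin dist0 x0 => [r| |]//; last by rewrite leey.
move=> r0 r1 cy uc fin ucfin ufin dist0 x0; rewrite lte_fin in r0.
rewrite lee_fin -ltNge in r1; have {}r1 := ltW r1.
(* Taking the root through [powR_cvg] requires a positive limit. If the norm of [c] is 0, then [c]
   is 0 and the norm of [u n] is the distance itself. *)
have [c0|cN0] := eqVneq (lpnorm w r%:E c) 0%E.
  rewrite c0 [fine 0%E]/=; apply/cvgrPdist_lt => e e0; near=> n.
  change (`|0 - fine (lpnorm w r%:E (u n))| < e).
  rewrite sub0r normrN ger0_norm//.
  have <- : u n - c = u n by rewrite (lpnorm_eq0 c0) subr0.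
  by near: n; exact: dist0.
have c0 : 0 < fine (lpnorm w r%:E c).
  rewrite -lte_fin fineK ?fin// lt_neqAle eq_sym cN0.
  exact: lpnorm_ge0.
have xr : fine (lpnorm w r%:E (u n)) `^ r @[n --> \oo] -->
    fine (lpnorm w r%:E c) `^ r.
  apply/cvgrPdist_lt => e e0.
  have e'0 : 0 < e `^ r^-1 by rewrite powR_gt0.
  near=> n.
  have un : lpnorm w r%:E (u n) \is a fin_num by near: n.
  have ucn : lpnorm w r%:E (u n - c) \is a fin_num by near: n.
  have dn : fine (lpnorm w r%:E (u n - c)) < e `^ r^-1 by near: n; exact: dist0.
  have dn' : fine (lpnorm w r%:E (u n - c)) `^ r < e.
    rewrite [ltRHS](_ : _ = (e `^ r^-1) `^ r); last first.
      by rewrite -powRrM mulVf ?gt_eqF// powRr1// ltW.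
    by apply: gt0_ltr_powR; rewrite ?nnegrE ?powR_ge0.
  apply: le_lt_trans dn'.
  have := le_lpnorm_dist_le1 (u n) c r0 r1.
  have := le_lpnorm_dist_le1 c (u n) r0 r1.
  rewrite (lpnormBC _ _ c) -(fineK (fin _ cy)) -(fineK un) -(fineK ucn).
  rewrite !poweR_EFin -!EFinD !lee_fin ler_norml => ? ?.
  by apply/andP; split; lra.
have xK (x : R) : 0 <= x -> (x `^ r) `^ r^-1 = x.
  by move=> x_ge0; rewrite -powRrM mulfV ?gt_eqF// powRr1.
have := powR_cvg (r := r^-1) (powR_gt0 _ c0) xr; rewrite xK//.
rewrite (_ : fine \o _ =
    fun n => (fine (lpnorm w r%:E (u n)) `^ r) `^ r^-1); first by apply.
by apply/funext => n; rewrite xK.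
Unshelve. all: by end_near. Qed.

Lemma null_seqB_cvg p (u : nat -> X -> H) c k :
  null_seq (lpnorm w p) (fun n => u n - c) -> u n k @[n --> \oo] --> c k.
Proof.
move=> uc; apply/cvg_rnormP => e e0.
have wk := weight_gt0 w (val k).
have [n0 Hn0] := uc _ (mulr_gt0 e0 wk); exists n0 => // n /= /Hn0 ucn.
rewrite -(ltr_pM2r wk) -lte_fin (le_lt_trans _ ucn)// lpnormBC.
exact: wnorm_le_lpnorm.
Qed.

(** Norm limits are determined by their coordinates, so uniqueness reduces to uniqueness of limits
    in [H]. *)
Lemma null_seqB_inj p (u v : nat -> X -> H) c c' :
  null_seq (lpnorm w p) (fun n => u n - c) ->
  null_seq (lpnorm w p) (fun n => v n - c') ->
  null_seq (lpnorm w p) (u - v) -> c = c'.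
Proof.
move=> uc vc uv; apply/funext => k.
have uv0 : null_seq (lpnorm w p) (fun n => (u - v) n - 0).
  by move=> e /uv[n0 Hn0]; exists n0 => n /Hn0; rewrite subr0.
apply/eqP; rewrite -subr_eq0; apply/eqP.
have h0 : (fun n => u n k - v n k) @ \oo --> (0 : H).
  exact: (null_seqB_cvg (k:=k) uv0).
have h1 : (fun n => u n k - v n k) @ \oo --> c k - c' k.
  exact: (cvgB (null_seqB_cvg (k:=k) uc) (null_seqB_cvg (k:=k) vc)).
exact: norm_cvg_unique h1 h0.
Qed.

(** The limit is built coordinatewise in the complete space [H]; [lpnorm_lsc] upgrades pointwise to
    norm convergence. *)
Lemma cauchy_seq_lp_cvg p (u : nat -> X -> H) :
  cauchy_seq (lpnorm w p) u ->
  exists c, null_seq (lpnorm w p) (fun n => u n - c).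
Proof.
move=> uC.
have ck k : cvgn (fun n => u n k).
  apply: rnorm_cauchy_cvg => e e0.
  have wk := weight_gt0 w (val k).
  have [n0 Hn0] := uC _ (mulr_gt0 e0 wk).
  exists n0 => m n n0m n0n; rewrite -(ltr_pM2r wk) -lte_fin.
  exact: le_lt_trans (wnorm_le_lpnorm _ _ _ _) (Hn0 _ _ n0m n0n).
exists (fun k => limn (fun n => u n k)) => e e0.
have e20 : 0 < e / 2 by rewrite divr_gt0.
have [n0 Hn0] := uC _ e20; exists n0 => n n0n.
(* Lower semicontinuity preserves only weak bounds, hence e/2; the shift by [n0] makes the bound
   hold for every term of the sequence in [m]. *)
apply: (@le_lt_trans _ _ (e / 2)%:E); last by rewrite lte_fin; lra.
apply: (@lpnorm_lsc _ _ _ _ _ p (fun m => u n - u (m + n0)%N)).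
- exact: ltW.
- move=> k; apply: cvgB; first exact: cvg_cst.
  by rewrite (cvg_shiftn n0 (fun m => u m k)); exact: ck.
- by move=> m; apply/ltW/Hn0 => //; exact: leq_addl.
Qed.

Lemma lp_space_limit p (u : nat -> X -> H) c : (forall n, lp_space w p (u n)) ->
  null_seq (lpnorm w p) (fun n => u n - c) -> lp_space w p c.
Proof.
move=> up uc.
have cy : (lpnorm w p c < +oo)%E.
  have [n0 /(_ _ (leqnn _)) H0] := uc _ ltr01.
  rewrite -(subKr (u n0) c); apply: lpnormB_lty; first exact: lp_space_lty.
  exact: lt_trans H0 (ltry _).
(* Finiteness of the norm settles every exponent but 0. There, a finitely supported approximation of
   one [u n0] close to [c] also approximates [c]. *)
move: up uc cy; rewrite /lp_space/=; case: eqVneq => // -> up uc.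
rewrite lpnorm0E => cy; split=> // e e0.
have [C C0 HC] := @lpnormZD _ _ X H w +oo%E 1; rewrite /lpnorm/= in HC.
have e'0 : 0 < e / C / 2 by rewrite !divr_gt0.
have [n0 /(_ _ (leqnn _))] := uc _ e'0; rewrite lpnormBC lpnorm0E => H0.
have [_ /(_ _ e'0)[g g0 gu]] := up n0; exists g => //.
rewrite -(subrKA (u n0)) -(scale1r (c - u n0)).
apply: (le_lt_trans (HC _ _)).
have -> : e = (C * (e / C / 2 + e / C / 2))%R.
  by rewrite -splitr mulrC divfK// gt_eqF.
by rewrite EFinM lte_pmul2l// ?lte_fin// EFinD lteD.
Qed.

Lemma null_seq_lpD p (a : R[i]) (u v : nat -> X -> H) :
  null_seq (lpnorm w p) u -> null_seq (lpnorm w p) v ->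
  null_seq (lpnorm w p) (fun n => a *: u n + v n).
Proof.
move=> u0 v0.
pose N := PreQuasiNorm (lpnorm_ge0 w p) (@lpnorm0 _ _ X H w p) (lpnormZD w p).
exact: (null_closed N).2 a u v u0 v0.
Qed.

End LpComplete.

(** * Transport of the Banach structure along an isometry into the sequence space *)

Section IsometricEmbedding.
Context {R : realType} {d : nat} {X : set 'rV[R]_d}.
Context {H : completeNormedModType R[i]}.
Variables (w : weight R d) (p : \bar R).
Variables (V : lmodType R[i]) (N : V -> \bar R) (F : V -> X -> H).
Hypotheses (Flin : linear F) (Fp : forall q, lp_space w p (F q)).
Hypotheses (FN : forall q, lpnorm w p (F q) = N q).
Hypothesis Finj : forall q, F q = 0 -> q = 0.

Let F0 : F 0 = 0.
Proof. by have := Flin (-1) 0 0; rewrite scaler0 addr0 scaleN1r addNr. Qed.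

Let FD q q' : F (q + q') = F q + F q'.
Proof. by have := Flin 1 q q'; rewrite !scale1r. Qed.

Let FZ a q : F (a *: q) = a *: F q.
Proof. by have := Flin a q 0; rewrite F0 !addr0. Qed.

Let FB q q' : F (q - q') = F q - F q'.
Proof. by rewrite FD -scaleN1r FZ scaleN1r. Qed.

Lemma isometry_quasi_norm : is_quasi_norm [set: V] N.
Proof.
split=> [//|q _|q _|a q _|].
- by rewrite -FN lpnorm_ge0 (lp_space_lty (Fp q)).
- by rewrite -FN => /lpnorm_eq0/Finj.
- by rewrite -!FN FZ lpnormZ.
have [C C0 HC] := @lpnormZD _ _ X H w p 1.
exists C => q q' _ _; rewrite -!FN FD -{1}(scale1r (F q)).
exact: HC.
Qed.

Lemma isometry_norm : (1 <= p)%E \/ p = 0%E -> is_norm [set: V] N.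
Proof.
move=> p1; split; first exact: isometry_quasi_norm.
by move=> q q' _ _; rewrite -!FN FD; exact: lpnormD_le.
Qed.

(** The image of a Cauchy sequence converges in the complete sequence space, and closedness of the
    range brings its limit back to [V]. *)
Lemma isometry_complete :
  (forall (q : nat -> V) c, lp_space w p c ->
    null_seq (lpnorm w p) (fun n => F (q n) - c) -> exists q', F q' = c) ->
  seq_complete [set: V] N.
Proof.
move=> Fclosed q _ qC.
have [|c qc] := @cauchy_seq_lp_cvg _ _ _ _ w p (fun n => F (q n)).
  move=> e /qC[n0 Hn0]; exists n0 => m n n0m n0n.
  by rewrite -FB FN; exact: Hn0.
have cp := lp_space_limit (fun n => Fp (q n)) qc.
have [q' q'c] := Fclosed _ _ cp qc.
exists q' => // e /qc[n0 Hn0]; exists n0 => n /Hn0.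
by rewrite -FN FB q'c.
Qed.

End IsometricEmbedding.

(** * Representatives of classes in a subquotient *)

Section Representatives.
Context {K : numFieldType} {V : lmodType K}.
Variables G N : Defs.subspace V.
Implicit Types q : subquotient G N.

Lemma representative_in q : subspace_set G (representative q).
Proof. exact/asboolP/(valP (repr q)). Qed.

(** [repr] picks its own member of each class, so [x] is recovered only modulo [N]. *)
Lemma representative_pi (x : subspace_type G) :
  subspace_set N (representative (\pi_(subquotient G N) x) - val x).
Proof.
have /subquotient_piP/asboolP :
    \pi_(subquotient G N) (repr (\pi_(subquotient G N) x)) =
    \pi_(subquotient G N) x by rewrite reprK.
by rewrite /= /relative_set raddfB.
Qed.

Lemma representative_linear (a : K) q q' :
  subspace_set N (representative (a *: q + q') -
    (a *: representative q + representative q')).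
Proof.
have -> : a *: q + q' = \pi_(subquotient G N) (a *: repr q + repr q').
  by rewrite -subquotient_pi_add reprK.
exact: (representative_pi (a *: repr q + repr q')).
Qed.

Lemma representative_eq0 q : subspace_set N (representative q) -> q = 0.
Proof.
move=> q0; have -> : 0 = \pi_(subquotient G N) 0.
  apply: (addrI (\pi_(subquotient G N) 0)).
  by rewrite subquotient_pi_add !addr0.
rewrite -(reprK q); apply/subquotient_piP/asboolP.
by rewrite /= /relative_set subr0.
Qed.

End Representatives.

(** * The analysis operator on the completion of [H00] *)

Section Completion.
Context {R : realType} {d : nat} {X : set 'rV[R]_d}.
Context {H : completeNormedModType R[i]}.
Variables (ip : {dot H for Num.conj}) (w : weight R d) (Td T : X -> bop H).
Variable p : \bar R.
Hypothesis p0 : (0 <= p)%E.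
Hypothesis H00p : forall x, H00_set ip T x -> lp_space w p (analysis Td x).

Local Notation Hp := (Hp_completion ip w Td T p).
Local Notation Fp := (@Hp_analysis _ _ _ _ ip w Td T p).
Implicit Types q : Hp.

Let analysisB x y : analysis Td (x - y) = analysis Td x - analysis Td y.
Proof. by rewrite addrC -scaleN1r analysisE scaleN1r addrC. Qed.

(** Analysis carries the representing Cauchy sequence to a Cauchy sequence of the sequence space.
    Its limit shows that [xget] selects from a nonempty set and does not fall back on 0. *)
Lemma Hp_analysisP q : lp_space w p (Fp q) /\
  null_seq (lpnorm w p) (fun n => analysis Td (representative q n) - Fp q).
Proof.
have [qS qC] := representative_in q.
have qp n : lp_space w p (analysis Td (representative q n)) by apply/H00p/qS.
have [|c qc] := @cauchy_seq_lp_cvg _ _ _ _ w p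
    (fun n => analysis Td (representative q n)).
  move=> e /qC[n0 Hn0]; exists n0 => m n n0m n0n.
  by rewrite -analysisB; exact: Hn0.
apply: (@xgetPex _ 0 [set c | lp_space w p c /\ null_seq (lpnorm w p)
  (fun n => analysis Td (representative q n) - c)]).
by exists c; split=> //; exact: lp_space_limit qc.
Qed.

(** Independence of the representative; linearity and closedness of the range use it with a
    convenient sequence [u]. *)
Lemma Hp_analysis_unique q (u : nat -> H) c :
  null_seq (lpnorm w p) (fun n => analysis Td (u n) - c) ->
  null_seq (H00_norm w Td p) (representative q - u) -> Fp q = c.
Proof.
move=> uc qu; apply: null_seqB_inj (Hp_analysisP q).2 uc _.
move=> e /qu[n0 Hn0]; exists n0 => n n0n.
by rewrite /= fctE /= -analysisB; exact: Hn0.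
Qed.

Lemma Hp_analysis_linear : linear Fp.
Proof.
move=> a q q'.
apply: (@Hp_analysis_unique _
  (fun n => a *: representative q n + representative q' n)).
  have := null_seq_lpD a (Hp_analysisP q).2 (Hp_analysisP q').2.
  move=> h e /h[n0 Hn0]; exists n0 => n /Hn0.
  by rewrite analysisE scalerBr opprD addrACA.
exact: (@representative_linear _ _
  (Subspace (cauchy_closed (H00 ip T) (H00_pre_quasi_norm w Td p)))
  (Subspace (null_closed (H00_pre_quasi_norm w Td p))) a q q').
Qed.

(** The norm being completed is that of the analysis coefficients, so the limit 0 says that the
    representing sequence is null. *)
Lemma Hp_analysis_eq0 q : Fp q = 0 -> q = 0.
Proof.
move=> q0; apply: representative_eq0 => e.
have [_ /[apply]-[n0 Hn0]] := Hp_analysisP q; exists n0 => n /Hn0.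
by rewrite q0 subr0.
Qed.

Lemma Hp_analysis_norm q : lpnorm w p (Fp q) = completion_norm q.
Proof.
have [qp qc] := Hp_analysisP q; apply/esym/cvg_lim => //.
exact: (lpnorm_cvg p0 (lp_space_lty qp) qc).
Qed.

(** A diagonal argument: replace each [q n] by an element of [H00] whose coefficients lie within
    1/(n+1) of those of [q n]. These elements form a Cauchy sequence, and its class is mapped to
    [c]. *)
Lemma Hp_analysis_closed (q : nat -> Hp) c : lp_space w p c ->
  null_seq (lpnorm w p) (fun n => Fp (q n) - c) -> exists q', Fp q' = c.
Proof.
move=> cp qc.
have [C C0 HC] := @lpnormZD _ _ X H w p 1.
have xP n : exists x, H00_set ip T x /\
    (lpnorm w p (analysis Td x - Fp (q n))%R < n.+1%:R^-1%:E)%E.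
  have e0 : 0 < n.+1%:R^-1 :> R by rewrite invr_gt0.
  have [_ /(_ _ e0)[n0 Hn0]] := Hp_analysisP (q n).
  exists (representative (q n) n0); split; last exact: Hn0.
  exact: (representative_in (q n)).1.
have [x xq] := choice xP.
have xc : null_seq (lpnorm w p) (fun n => analysis Td (x n) - c).
  have := @null_seq_lpD _ _ _ _ w p 1 (fun n => analysis Td (x n) - Fp (q n))
    (fun n => Fp (q n) - c) _ qc.
  move=> h e e0; have [|n0 Hn0] := h _ e e0.
    move=> e' e'0.
    have [n0 _ Hn0] := near_infty_natSinv_lt (PosNum e'0).
    exists n0 => n n0n; apply: lt_trans (xq n).2 _.
    by rewrite lte_fin; exact: Hn0.
  by exists n0 => n /Hn0; rewrite scale1r subrKA.
have xC : cauchy_set (H00 ip T) (H00_pre_quasi_norm w Td p) x.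
  split=> [n|e e0]; first exact: (xq n).1.
  have e'0 : 0 < e / C / 2 by rewrite !divr_gt0.
  have [n0 Hn0] := xc _ e'0; exists n0 => m n n0m n0n /=.
  rewrite analysisB -(subrKA c) -(scale1r (_ - c)).
  apply: (le_lt_trans (HC _ _)).
  have -> : e = (C * (e / C / 2 + e / C / 2))%R.
    by rewrite -splitr mulrC divfK// gt_eqF.
  rewrite EFinM lte_pmul2l// ?lte_fin// EFinD lteD ?Hn0//.
  by rewrite lpnormBC Hn0.
pose G := Subspace (cauchy_closed (H00 ip T) (H00_pre_quasi_norm w Td p)).
pose x' : subspace_type G := SubspaceType (@mem_subspace _ _ G _ xC).
exists (\pi_Hp x'); apply: Hp_analysis_unique xc _.
exact: (@representative_pi _ _ G
  (Subspace (null_closed (H00_pre_quasi_norm w Td p))) x').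
Qed.

End Completion.

(** * Unconditional sums over the index set *)

Section Sums.
Context {R : realType} {I : choiceType} {V : normedModType R[i]}.
Implicit Types (F : I -> V) (A : {fset I}).

Lemma partial_sumE F A : partial_sum F A = \sum_(i <- A) F i.
Proof. by rewrite big_seq_fsetE. Qed.

End Sums.

Lemma sum_fsetD {I : choiceType} {V : zmodType} (F : I -> V) (A B : {fset I}) :
  (A `<=` B)%fset ->
  \sum_(i <- B) F i = \sum_(i <- A) F i + \sum_(i <- (B `\` A)%fset) F i.
Proof.
move=> AB; rewrite (big_fsetID _ (mem A))/=; congr (_ + _).
  by congr (\sum_(i <- enum_fset _) F i); apply/fsetP => i; rewrite !inE;
    apply: andb_idl => /(fsubsetP AB).
by congr (\sum_(i <- enum_fset _) F i); apply/fsetP => i; rewrite !inE andbC.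
Qed.

Lemma ler_sum_fset {I : choiceType} {R : numDomainType} (F : I -> R)
    (A B : {fset I}) : (forall i, 0 <= F i) ->
  (A `<=` B)%fset -> \sum_(i <- A) F i <= \sum_(i <- B) F i.
Proof.
by move=> F0 AB; rewrite (sum_fsetD F AB) lerDl sumr_ge0.
Qed.

Section HasSum.
Context {R : realType} {d : nat} {X : set 'rV[R]_d}.
Context {V : normedModType R[i]}.
Implicit Types (F : X -> V) (s : V) (A D : {fset X}).

Lemma has_sumP F s : has_sum F s <-> forall e : R, 0 < e ->
  exists D : {fset X}, forall A : {fset X}, (D `<=` A)%fset ->
    rnorm (s - \sum_(i <- A) F i) < e.
Proof.
rewrite /has_sum; split=> [/cvg_rnormP Fs e /Fs[D _ DP]|Fs].
  by exists D => A /DP; rewrite /= partial_sumE.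
apply/cvg_rnormP => e /Fs[D DP]; exists D => // A /DP.
by rewrite partial_sumE.
Qed.

Lemma has_sum_unique F s s' : has_sum F s -> has_sum F s' -> s = s'.
Proof.
exact: (@norm_cvg_unique _ V (partial_sum F @ totally) _).
Qed.

Lemma has_sum_finite F D : (forall i, i \notin D -> F i = 0) ->
  has_sum F (\sum_(i <- D) F i).
Proof.
move=> F0; apply/has_sumP => e e0; exists D => A DA.
rewrite -(big_fset_incl _ DA) ?subrr ?rnorm0// => i _; exact: F0.
Qed.

End HasSum.

(** * Real-valued operator norms *)

Section Operators.
Context {R : realType} {H : completeNormedModType R[i]}.
Implicit Types (S : bop H) (x : H).

Lemma opnorm_fin S : opnorm S \is a fin_num.
Proof.
have [_ [M SM]] := bopP S; rewrite ge0_fin_numE.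
  apply: (@le_lt_trans _ _ `|M|%:E); last exact: ltry.
  apply: ge_ereal_sup => _ [x /= x1 <-]; rewrite lee_fin (le_trans (SM x))//.
  apply: (@le_trans _ _ (`|M| * rnorm x)).
    by rewrite ler_wpM2r ?rnorm_ge0 ?ler_norm.
  by rewrite ler_piMr.
apply: ereal_sup_ubound; exists 0; first by rewrite /= rnorm0.
by rewrite linear0 rnorm0.
Qed.

Definition ropnorm S : R := fine (opnorm S).

Lemma ropnorm_ub S x : rnorm x <= 1 -> rnorm (S x) <= ropnorm S.
Proof.
move=> x1; rewrite -lee_fin /ropnorm fineK ?opnorm_fin//.
by apply: ereal_sup_ubound; exists x.
Qed.

Lemma ropnorm_ge0 S : 0 <= ropnorm S.
Proof.
by apply: (@le_trans _ _ (rnorm (S 0))); rewrite ?rnorm_ge0 ?ropnorm_ub ?rnorm0.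
Qed.

Lemma le_ropnorm S x : rnorm (S x) <= ropnorm S * rnorm x.
Proof.
have [xN0|xN0] := eqVneq (rnorm x) 0.
  by rewrite (rnorm_eq0 xN0) linear0 rnorm0 mulr0.
have x0 : 0 < rnorm x by rewrite lt_neqAle eq_sym xN0 rnorm_ge0.
have xE : rnorm ((rnorm x)^-1)%:C%C = (rnorm x)^-1.
  by rewrite rnorm_real ger0_norm// invr_ge0 ltW.
rewrite -ler_pdivrMr// mulrC.
have := @ropnorm_ub S (((rnorm x)^-1)%:C%C *: x).
by rewrite linearZ/= !rnormZ xE mulVf// lexx; apply.
Qed.

Lemma bop_cvg {T : Type} {F : set_system T} {FF : Filter F} S (u : T -> H) x :
  u @ F --> x -> S (u t) @[t --> F] --> S x.
Proof.
move=> /cvg_rnormP ux; apply/cvg_rnormP => e e0.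
have M0 : 0 < ropnorm S + 1 by rewrite ltr_wpDl ?ropnorm_ge0.
move: (ux _ (divr_gt0 e0 M0)); apply: filterS => t.
rewrite -linearB/= => H1; apply: le_lt_trans (le_ropnorm _ _) _.
rewrite ltr_pdivlMr// mulrC in H1; apply: le_lt_trans H1.
by rewrite ler_wpM2r ?rnorm_ge0// lerDl.
Qed.

End Operators.

(** * Finitely supported sequences and the exponent 0 *)

Section Admissible.
Context {R : realType} {d : nat} {X : set 'rV[R]_d}.
Context {H : completeNormedModType R[i]}.
Variables (w : weight R d).
Implicit Types (p : \bar R) (f g c : X -> H) (k l : X).

Lemma lp_spaceE p f :
  p != 0%E -> lp_space w p f = (lpnorm w p f < +oo)%E :> Prop.
Proof. by rewrite /lp_space/= => /negPf ->. Qed.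

Lemma l00_fset c : l00 c ->
  exists D : {fset X}, forall k, k \notin D -> c k = 0.
Proof.
move=> c0; exists (fset_set [set k | c k != 0]) => k.
by rewrite in_fset_set// notin_setE/= => /negP/negPn/eqP.
Qed.

Lemma fset_l00 c (D : {fset X}) : (forall k, k \notin D -> c k = 0) -> l00 c.
Proof.
move=> c0; apply: sub_finite_set (finite_fset D) => k /=.
by apply: contraNT => /c0 ->.
Qed.

Lemma l00_lty p c : l00 c -> (lpnorm w p c < +oo)%E.
Proof.
move=> /l00_fset[D cD].
have [[r r0 ->]|->] := lpnorm_case w p (X := X) (H := H).
  set s := \sum_(k <- D) wnorm w c k `^ r.
  apply: (@le_lt_trans _ _ (s `^ r^-1)%:E); last exact: ltry.
  apply/lpnorm_leP; rewrite ?powR_ge0// => A.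
  have s0 : 0 <= s by apply: sumr_ge0 => k _; exact: powR_ge0.
  rewrite -powRrM mulVf ?gt_eqF// powRr1//.
  have c0 k : k \notin D -> wnorm w c k `^ r = 0.
    by move=> /cD ck; rewrite /wnorm ck rnorm0 mul0r powR0// gt_eqF.
  have cB (B : {fset X}) : (D `<=` B)%fset ->
      \sum_(k <- B) wnorm w c k `^ r = s.
    by move=> DB; apply/esym/big_fset_incl => // k _; exact: c0.
  rewrite -(cB (A `|` D)%fset (fsubsetUr _ _)).
  by apply: ler_sum_fset (fsubsetUl _ _) => k; exact: powR_ge0.
apply: (@le_lt_trans _ _ (\sum_(k <- D) wnorm w c k)%:E); last exact: ltry.
apply/linfnorm_leP; first by apply: sumr_ge0 => k _; exact: wnorm_ge0.
move=> k; have [kD|/cD ck] := boolP (k \in D).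
  by rewrite (big_fsetD1 k)//= lerDl sumr_ge0// => i _; exact: wnorm_ge0.
rewrite /wnorm ck rnorm0 mul0r sumr_ge0// => i _; exact: wnorm_ge0.
Qed.

(** Admissibility says nothing about the exponent 0, which is reached through the exponent 1: a
    summable sequence is uniformly small off a finite set. *)
Lemma l1_l0 f : (lpnorm w 1%E f < +oo)%E -> lp_space w 0%E f.
Proof.
move=> fy; have := lpnorm_ge0 w 1%E f.
case E : (lpnorm w 1%E f) fy => [s| |]// _; rewrite lee_fin => s0.
rewrite /lp_space/= eqxx; split.
  apply: (@le_lt_trans _ _ s%:E); last exact: ltry.
  by apply/linfnorm_leP => // k; rewrite -lee_fin -E wnorm_le_lpnorm.
move=> e e0.
have fA (A : {fset X}) : \sum_(k <- A) wnorm w f k <= s.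
  have := (lpnorm_leP w f ltr01 s0).1; rewrite E => /(_ (lexx _) A).
  by rewrite powRr1//; under eq_bigr do rewrite powRr1 ?wnorm_ge0//.
(* Otherwise s - e/2 would bound all finite sums, hence the norm [s]. *)
have [A sA] : exists A : {fset X}, s - e / 2 < \sum_(k <- A) wnorm w f k.
  apply: contrapT => /forallNP sA.
  have se0 : 0 <= s - e / 2.
    by have /negP := sA fset0; rewrite big_seq_fset0 -leNgt.
  have : (lpnorm w 1%:E f <= (s - e / 2)%:E)%E.
    apply/lpnorm_leP => // A; rewrite powRr1//.
    under eq_bigr do rewrite powRr1 ?wnorm_ge0//.
    by rewrite leNgt; exact/negP.
  by rewrite E lee_fin; lra.
exists (fun k => if k \in A then f k else 0).
  by apply: (@fset_l00 _ A) => k /negPf ->.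
apply: (@le_lt_trans _ _ (e / 2)%:E); last by rewrite lte_fin; lra.
apply/linfnorm_leP; first by rewrite divr_ge0// ltW.
move=> k.
rewrite /wnorm !fctE; case: ifPn => kA.
  by rewrite subrr rnorm0 mul0r divr_ge0// ltW.
(* Adding [k] to [A] cannot push the sum above [s], so the entry at [k] is below e/2. *)
have := fA (k |` A)%fset; rewrite big_fsetU1//= subr0 -/(wnorm w f k).
lra.
Qed.

End Admissible.

(** * Row sums and bounded pointwise limits of the matrix action *)

Section MatrixAction.
Context {R : realType} {d : nat} {X : set 'rV[R]_d}.
Context {H : completeNormedModType R[i]}.
Variable w : weight R d.
Implicit Types (A : opmatrix X (H:=H)) (p : \bar R) (f g c : X -> H).
Implicit Types (k l : X) (D : {fset X}).

Lemma mx_act_fset A c D : (forall l, l \notin D -> c l = 0) ->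
  mx_act A c (fun k => \sum_(l <- D) A k l (c l)).
Proof.
by move=> c0 k; apply: has_sum_finite => l /c0 ->; exact: linear0.
Qed.

Lemma mx_act_unique A f g g' : mx_act A f g -> mx_act A f g' -> g = g'.
Proof.
by move=> fg fg'; apply/funext => k; exact: has_sum_unique (fg k) (fg' k).
Qed.

Lemma mx_bounded_fset p A : mx_bounded w p A -> exists M : R, forall c D,
  lp_space w p c -> (forall l, l \notin D -> c l = 0) ->
  (lpnorm w p (fun k => \sum_(l <- D) A k l (c l))%R <=
   M%:E * lpnorm w p c)%E.
Proof.
move=> [M HM]; exists M => c D cp c0; have [g cg gM] := HM c cp.
by rewrite (mx_act_unique (mx_act_fset c0) cg).
Qed.

(** Multiples of the identity with nonnegative coefficients cannot cancel, so on a suitable test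
    vector coordinate [k] displays the whole row sum. *)
Lemma rowsum_bound A :
  mx_bounded w +oo%E
    ((fun k l => (ropnorm (A k l))%:C%C *: bop_id) : opmatrix X (H:=H)) ->
  forall k, exists M : R, forall D,
    \sum_(l <- D) ropnorm (A k l) / w (val l) <= M.
Proof.
move=> /mx_bounded_fset[M HM] k.
have wk l := weight_gt0 w (val l).
(* Without a unit vector, [H] is zero and so are all operator norms. *)
have [[e e1]|noe] := pselect (exists e : H, rnorm e = 1); last first.
  have H0 (x : H) : rnorm x = 0.
    apply: contrapT => /eqP xN0; apply: noe.
    exists (((rnorm x)^-1)%:C%C *: x); rewrite rnormZ rnorm_real.
    by rewrite ger0_norm ?invr_ge0 ?rnorm_ge0// mulVf.
  exists 0 => D; rewrite big1// => l _.
  suff -> : ropnorm (A k l) = 0 by rewrite mul0r.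
  apply/eqP; rewrite eq_le ropnorm_ge0 andbT.
  rewrite -lee_fin /ropnorm fineK ?opnorm_fin//.
  by apply: ge_ereal_sup => _ [x _ <-]; rewrite H0.
(* Test the matrix on the finitely supported sequence [l |-> e / w l]. *)
exists (`|M| / w (val k)) => D.
pose c (l : X) : H := if l \in D then ((w (val l))^-1)%:C%C *: e else 0.
have c0 l : l \notin D -> c l = 0 by rewrite /c => /negPf ->.
have c1 : (lpnorm w +oo%E c <= 1%:E)%E.
  apply/linfnorm_leP => // l; rewrite /wnorm /c; case: ifP => _.
    rewrite rnormZ e1 mulr1 rnorm_real ger0_norm ?invr_ge0 ?(ltW (wk l))//.
    by rewrite mulVf ?gt_eqF.
  by rewrite rnorm0 mul0r.
have cp : lp_space w +oo%E c.
  by rewrite lp_spaceE//; apply: le_lt_trans c1 (ltry _).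
have {}HM := HM c D cp c0.
have := le_trans (wnorm_le_lpnorm w +oo%E _ k) HM.
rewrite /wnorm; set s := \sum_(l <- D) _ / _.
have -> : \sum_(l <- D) ((ropnorm (A k l))%:C%C *: bop_id : bop H) (c l) =
    s%:C%C *: e.
  rewrite rmorph_sum scaler_suml /=; apply: eq_big_seq => l lD.
  rewrite /c lD [LHS]scalerA; congr (_ *: _).
  by rewrite rmorphM.
have s0 : 0 <= s.
  by apply: sumr_ge0 => l _; rewrite divr_ge0 ?ropnorm_ge0// ltW.
rewrite rnormZ e1 mulr1 rnorm_real ger0_norm// => sM.
rewrite ler_pdivlMr// -lee_fin (le_trans sM)//.
apply: (@le_trans _ _ (`|M|%:E * lpnorm w +oo%E c)%E).
  by rewrite lee_wpmul2r ?lpnorm_ge0// lee_fin ler_norm.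
by rewrite -[leRHS]mule1 lee_wpmul2l// lee_fin.
Qed.

(** Take [D] with a sum within e of the supremum; a set disjoint from [D] can add at most e. *)
Lemma rowsum_tail A k : (exists M : R, forall D,
    \sum_(l <- D) ropnorm (A k l) / w (val l) <= M) ->
  forall e : R, 0 < e -> exists D, forall D', [disjoint D & D']%fset ->
    \sum_(l <- D') ropnorm (A k l) / w (val l) <= e.
Proof.
move=> [M HM] e e0; pose a l := ropnorm (A k l) / w (val l).
pose E := [set \sum_(l <- D) a l | D in [set: {fset X}]].
have supE : has_sup E.
  by split; [exists (\sum_(l <- fset0) a l), fset0|exists M => _ [D _ <-]].
have [_ [D _ <-] Ds] := sup_adherent e0 supE.
exists D => D' DD'.
have : \sum_(l <- (D `|` D')%fset) a l <= sup E.
  by apply: sup_ubound; [exact: supE.2|exists (D `|` D')%fset].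
rewrite (sum_fsetD _ (fsubsetUl _ _)).
rewrite (_ : ((D `|` D') `\` D = D')%fset); last first.
  apply/fsetP => l; rewrite !inE; case: (boolP (l \in D')) => lD'; last first.
    by rewrite orbF andNb.
  rewrite orbT andbT; apply/negP => lD.
  by have /fdisjointP/(_ _ lD)/negP := DD'.
by rewrite -/(a _) -[X in X <= e]/(\sum_(l <- D') a l); lra.
Qed.

(** Off [D], each term is at most [B] times the norm of its matrix entry divided by the weight.
    Enlarging [D] by a set that nearly attains [g k] leaves only a finite tail to estimate. *)
Lemma mx_act_tail A f g (B e : R) k D :
  mx_act A f g -> (lpnorm w +oo%E f <= B%:E)%E -> 0 <= B ->
  (forall D', [disjoint D & D']%fset ->
    \sum_(l <- D') ropnorm (A k l) / w (val l) <= e) ->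
  rnorm (g k - \sum_(l <- D) A k l (f l)) <= e * B.
Proof.
move=> fg fB B0 De; apply/ler_addgt0Pl => a a0.
have [D1 HD1] := (has_sumP _ _).1 (fg k) a a0.
have := HD1 (D1 `|` D)%fset (fsubsetUl _ _).
rewrite (sum_fsetD _ (fsubsetUr _ _)); set s' := \sum_(l <- (_ `\` _)%fset) _.
set s := \sum_(l <- D) _ => gs.
rewrite (_ : g k - s = (g k - (s + s')) + s'); last first.
  by rewrite opprD addrA subrK.
apply: le_trans (rnormD _ _) _; apply: lerD; first exact: ltW.
apply: le_trans (rnorm_sum _ _ _) _.
apply: (@le_trans _ _ ((\sum_(l <- ((D1 `|` D) `\` D)%fset)
    ropnorm (A k l) / w (val l)) * B)); last first.
  rewrite ler_wpM2r// De//; apply/fdisjointP => l lD.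
  by rewrite !inE lD.
rewrite mulr_suml; apply: ler_sum => l _.
apply: le_trans (le_ropnorm _ _) _.
have wl := weight_gt0 w (val l).
rewrite -mulrA ler_wpM2l ?ropnorm_ge0//.
rewrite mulrC ler_pdivlMr//.
by rewrite -lee_fin (le_trans _ fB)//; exact: wnorm_le_lpnorm.
Qed.

(** Dominated convergence: the tail estimate is uniform in [n], and on a fixed finite set the limit
    passes through the sum. *)
Lemma mx_act_limit A (u v : nat -> X -> H) f g (B : R) :
  (forall k, exists M : R, forall D,
    \sum_(l <- D) ropnorm (A k l) / w (val l) <= M) ->
  (forall n, mx_act A (u n) (v n)) ->
  (forall n, (lpnorm w +oo%E (u n) <= B%:E)%E) ->
  (forall l, u n l @[n --> \oo] --> f l) ->
  (forall k, v n k @[n --> \oo] --> g k) -> mx_act A f g.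
Proof.
move=> AM uv uB uf vg k.
have B0 : 0 <= B by rewrite -lee_fin (le_trans (lpnorm_ge0 w +oo%E (u 0%N))).
(* The divisor is [B + 1] because [B] may be 0; it also turns the weak bound in the limit into a
   strict one. *)
apply/has_sumP => e e0; have B1 : 0 < B + 1 by rewrite ltr_wpDl.
have [D HD] := rowsum_tail (AM k) (divr_gt0 e0 B1).
exists D => D' DD'; apply: (@le_lt_trans _ _ (e / (B + 1) * B)); last first.
  by rewrite -mulrA -[ltRHS]mulr1 ltr_pM2l// mulrC ltr_pdivrMr// mul1r ltrDl.
have : rnorm (v n k - \sum_(l <- D') A k l (u n l)) @[n --> \oo] -->
    rnorm (g k - \sum_(l <- D') A k l (f l)).
  apply: cvg_rnorm; apply: cvgB; first exact: vg.
  by apply: cvg_sum_seq => l; apply: bop_cvg; exact: uf.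
move=> /cvgr_to_le; apply; near=> n.
apply: mx_act_tail => // D1 DD1; apply: HD.
by apply: fdisjointWl DD1.
Unshelve. all: by end_near. Qed.

End MatrixAction.

(** Sublevel sets of an injection into the naturals. They turn limits along finite subsets into
    limits of sequences. *)
Lemma countable_exhaustion {T : choiceType} (X : set T) : countable X ->
  exists F : nat -> {fset X}, forall A : {fset X}, exists n0, forall n,
    (n0 <= n)%N -> (A `<=` F n)%fset.
Proof.
move=> /countable_injP[f finj].
have fin n : finite_set [set k : X | (f (val k) < n)%N].
  apply: (@finite_preimage _ _ `I_n (fun k : X => f (val k))).
    move=> k l _ _ /finj kl; apply: val_inj; apply: kl; rewrite inE.
      exact: set_valP k.
    exact: set_valP l.
  exact: finite_II.
exists (fun n => fset_set [set k : X | (f (val k) < n)%N]) => A.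
exists (\max_(k <- A) f (val k)).+1 => n fn.
apply/fsubsetP => k kA; rewrite in_fset_set// inE/=.
apply: leq_trans fn; rewrite ltnS.
by apply: (@leq_bigmax_seq _ _ xpredT (fun k : X => f (val k))).
Qed.

(** * The Gram matrix and analysis coefficients *)

Section Gramian.
Context {R : realType} {d : nat} {X : set 'rV[R]_d}.
Context {H : completeNormedModType R[i]}.
Variables (ip : {dot H for Num.conj}) (w : weight R d) (Td T : X -> bop H).
Implicit Types (c : X -> H) (x : H).

(** The matrix whose membership in the algebra is [algebra_similar ip AA Td T]. *)
Definition gramian : opmatrix X (H:=H) :=
  fun k l => bop_comp (Td k) (adjoint ip (T l)).

Lemma analysis_synthesis c (D : {fset X}) :
  (forall k, k \notin D -> c k = 0) ->
  analysis Td (synthesis ip T c) = fun k => \sum_(l <- D) gramian k l (c l).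
Proof.
move=> c0; apply/funext => k; rewrite /analysis (synthesisE _ _ c0).
by rewrite linear_sum.
Qed.

Lemma H00_analysis_lty (p : \bar R) : p != 0%E -> mx_bounded w p gramian ->
  forall x, H00_set ip T x -> (lpnorm w p (analysis Td x) < +oo)%E.
Proof.
move=> p0 /mx_bounded_fset[M HM] _ [c /[dup] c00 /l00_fset[D cD] <-].
have cp := l00_lty w p c00.
rewrite (analysis_synthesis cD).
apply: le_lt_trans (HM c D _ cD) _; first by rewrite lp_spaceE.
case: (lpnorm w p c) (lpnorm_ge0 w p c) cp => // b _ _.
exact: ltry.
Qed.

(** Apply the continuous operator [Td k] to the reconstruction of [x]. *)
Lemma mx_act_gramian :
  (forall x, has_sum (fun l => adjoint ip (T l) (Td l x)) x) ->
  forall x, mx_act gramian (analysis Td x) (analysis Td x).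
Proof.
move=> rec x k.
have h : (fun A => Td k (partial_sum (fun l => adjoint ip (T l) (Td l x)) A))
    @ totally --> Td k x by apply: bop_cvg; exact: rec.
rewrite /has_sum (_ : partial_sum _ =
  fun A => Td k (partial_sum (fun l => adjoint ip (T l) (Td l x)) A))//.
by apply/funext => A; rewrite !partial_sumE linear_sum.
Qed.

End Gramian.

(** * The space of classes of sequences for the exponent [+oo] *)

Section Hinfty.
Context {R : realType} {d : nat} {X : set 'rV[R]_d}.
Context {H : completeNormedModType R[i]}.
Variables (ip : {dot H for Num.conj}) (w : weight R d) (Td T : X -> bop H).
Hypothesis Xcount : countable X.
Hypothesis recon : forall x, has_sum (fun l => adjoint ip (T l) (Td l x)) x.
Hypothesis Gbounded : mx_bounded w +oo%E (gramian ip Td T).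
Hypothesis Grow : forall k, exists M : R, forall D : {fset X},
  \sum_(l <- D) ropnorm (gramian ip Td T k l) / w (val l) <= M.

Local Notation Hi := (Hinf w Td).
Local Notation Fi := (@Hinf_analysis _ _ _ _ w Td).
Implicit Types q : Hi.

Lemma sup_boundedP (u : nat -> H) : sup_bounded w Td u <->
  exists2 B : R, 0 <= B & forall n, (linfnorm w (analysis Td (u n)) <= B%:E)%E.
Proof.
split=> [|[B B0 uB]].
  rewrite /sup_bounded; set s := ereal_sup _ => sy.
  have su n : (linfnorm w (analysis Td (u n)) <= s)%E.
    by apply: ereal_sup_ubound; exists n.
  have s0 : (0 <= s)%E := le_trans (linfnorm_ge0 _ _) (su 0%N).
  case: s s0 su sy => // B B0 uB _; exists B => //.
apply: (@le_lt_trans _ _ B%:E); last exact: ltry.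
by apply: ge_ereal_sup => _ [n _ <-].
Qed.

Lemma Hinf_analysis_cvg q k :
  Td k (representative q n) @[n --> \oo] --> Fi q k.
Proof. exact: ((representative_in q).1 k). Qed.

(** A pointwise null difference does not change the coordinate limits. *)
Lemma Hinf_analysis_unique q (u : nat -> H) c :
  (forall k, Td k (u n) @[n --> \oo] --> c k) ->
  Hinf_null_set w Td (representative q - u) -> Fi q = c.
Proof.
move=> uc [qu _]; apply/funext => k.
have h : (fun n => Td k ((representative q - u) n) + Td k (u n)) @ \oo -->
    0 + c k by exact: cvgD (qu k) (uc k).
apply: norm_cvg_unique (@Hinf_analysis_cvg q k) _.
rewrite -[c k]add0r (_ : (fun n => Td k (representative q n)) =
  fun n => Td k ((representative q - u) n) + Td k (u n))//.
by apply/funext => n; rewrite !fctE -linearD subrK.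
Qed.

Lemma Hinf_analysis_linear : linear Fi.
Proof.
move=> a q q'.
apply: (@Hinf_analysis_unique _
  (fun n => a *: representative q n + representative q' n)).
  move=> k.
  rewrite (_ : (fun n => Td k _) = fun n => a *: Td k (representative q n) +
    Td k (representative q' n)); last by apply/funext => n; rewrite linearP.
  apply: cvgD; last exact: Hinf_analysis_cvg.
  exact: (@cvgZl_tmp _ H nat \oo _ a _ _ (@Hinf_analysis_cvg q k)).
exact: (@representative_linear _ _ (Subspace (Hinf_closed w Td))
  (Subspace (Hinf_null_closed w Td)) a q q').
Qed.

Lemma Hinf_analysis_lp q : lp_space w +oo%E (Fi q).
Proof.
have [B B0 qB] := (sup_boundedP _).1 (representative_in q).2.
rewrite lp_spaceE//; apply: (@le_lt_trans _ _ B%:E); last exact: ltry.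
apply: (@lpnorm_lsc _ _ _ _ _ +oo%E
  (fun n => analysis Td (representative q n))) => //.
exact: Hinf_analysis_cvg.
Qed.

(** The uniform bound in the null set already holds for any representative; only the coordinate
    limits have to vanish. *)
Lemma Hinf_analysis_eq0 q : Fi q = 0 -> q = 0.
Proof.
move=> q0; apply: representative_eq0; split; last first.
  exact: (representative_in q).2.
by move=> k; have := @Hinf_analysis_cvg q k; rewrite q0.
Qed.

(** The coefficients of each term of a representative are fixed by the Gram matrix and uniformly
    bounded, so [mx_act_limit] applies. *)
Lemma mx_act_Hinf q : mx_act (gramian ip Td T) (Fi q) (Fi q).
Proof.
have [B B0 qB] := (sup_boundedP _).1 (representative_in q).2.
apply: (mx_act_limit Grow (u := fun n => analysis Td (representative q n))
  (v := fun n => analysis Td (representative q n)) (B := B)) => //.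
- by move=> n; exact: mx_act_gramian.
- exact: Hinf_analysis_cvg.
- exact: Hinf_analysis_cvg.
Qed.

Lemma Hinf_analysis_closed (q : nat -> Hi) c : lp_space w +oo%E c ->
  null_seq (lpnorm w +oo%E) (fun n => Fi (q n) - c) -> exists q', Fi q' = c.
Proof.
move=> cp qc; have cy := lp_space_lty cp.
have cfin : lpnorm w +oo%E c \is a fin_num.
  by rewrite ge0_fin_numE ?lpnorm_ge0.
set b := fine (lpnorm w +oo%E c).
have cb : (lpnorm w +oo%E c <= b%:E)%E by rewrite fineK.
have b0 : 0 <= b by rewrite fine_ge0 ?lpnorm_ge0.
(* The limit [c] is again a fixed point. The index shift by [n0] keeps all terms within distance 1
   of [c], hence the common bound [b + 1]. *)
have Gc : mx_act (gramian ip Td T) c c.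
  have [n0 Hn0] := qc _ ltr01.
  have qk k : Fi (q (n + n0)%N) k @[n --> \oo] --> c k.
    rewrite (cvg_shiftn n0 (fun m => Fi (q m) k)).
    exact: null_seqB_cvg qc.
  apply: (mx_act_limit Grow (u := fun n => Fi (q (n + n0)%N))
    (v := fun n => Fi (q (n + n0)%N)) (B := b + 1)) => //.
    by move=> n; exact: mx_act_Hinf.
  move=> n; rewrite -(subrK c (Fi _)).
  apply: le_trans (lpnormD_le _ _ _ _) _; first by left; rewrite leey.
  by rewrite addeC EFinD leeD// ltW// Hn0// leq_addl.
have [F HF] := countable_exhaustion Xcount.
(* The preimage of [c] is the class of the synthesized truncations of [c]. *)
pose cF n (l : X) : H := if l \in F n then c l else 0.
have cF0 n l : l \notin F n -> cF n l = 0 by rewrite /cF => /negPf ->.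
pose x n := synthesis ip T (cF n).
have xE n : analysis Td (x n) =
    fun k => \sum_(l <- F n) gramian ip Td T k l (cF n l).
  by apply: analysis_synthesis => l; exact: cF0.
(* The coefficients of [x n] at [k] are partial sums over [F n] of the series for (G c)_k = c_k. *)
have xc k : Td k (x n) @[n --> \oo] --> c k.
  apply/cvg_rnormP => e e0; have [D HD] := (has_sumP _ _).1 (Gc k) e e0.
  have [n0 Hn0] := HF D; exists n0 => // n /Hn0/HD.
  have -> : Td k (x n) = analysis Td (x n) k by [].
  rewrite xE; congr (rnorm (_ - _) < _); apply: eq_big_seq => l lF.
  by rewrite /cF lF.
(* Truncation does not increase the norm, and the Gram matrix is bounded; [|M|] replaces a constant
   of unknown sign. *)
have xb : sup_bounded w Td x.
  have [M HM] := mx_bounded_fset Gbounded.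
  apply/sup_boundedP; exists (`|M| * b); first by rewrite mulr_ge0.
  move=> n; rewrite xE.
  have cFc : (lpnorm w +oo%E (cF n) <= lpnorm w +oo%E c)%E.
    apply: le_lpnorm => l; rewrite /wnorm /cF; case: ifP => // _.
    by rewrite rnorm0 mul0r; exact: wnorm_ge0.
  apply: le_trans (HM (cF n) (F n) _ (@cF0 n)) _.
    by rewrite lp_spaceE//; apply: le_lt_trans cFc cy.
  apply: (@le_trans _ _ (`|M|%:E * lpnorm w +oo%E (cF n))%E).
    by rewrite lee_wpmul2r ?lpnorm_ge0// lee_fin ler_norm.
  rewrite EFinM lee_wpmul2l ?lee_fin//.
  exact: le_trans cFc cb.
have xG : Hinf_set w Td x by split=> // k; exact: cvgP (xc k).
pose G := Subspace (Hinf_closed w Td).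
pose x' : subspace_type G := SubspaceType (@mem_subspace _ _ G _ xG).
exists (\pi_Hi x'); apply: Hinf_analysis_unique xc _.
exact: (@representative_pi _ _ G (Subspace (Hinf_null_closed w Td)) x').
Qed.

End Hinfty.

(** * Assembly over all exponents *)

Theorem corollary3p18 (R : realType) (d : nat) (X : set 'rV[R]_d)
    (H : completeNormedModType R[i]) (ip : {dot H for Num.conj})
    (AA : set (opmatrix X (H:=H))) (nA : opmatrix X (H:=H) -> R)
    (p0 : R) (w : weight R d) (T Td : X -> bop H) :
  countable X ->
  separable_hilbert ip ->
  spectral_algebra ip AA nA ->
  0 < p0 -> p0 <= 1 ->
  admissible AA p0 w ->
  gframe T ->
  dual_gframe ip T Td ->
  algebra_similar ip AA Td T ->
  [/\ forall p : \bar R, (1 <= p)%E \/ p = 0%E ->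
        banach [set: Hpw ip w Td T p] (Hpw_norm ip w Td T p),
      forall p : R, p0 < p -> p < 1 ->
        quasi_banach [set: Hpw ip w Td T p%:E]
          (Hpw_norm ip w Td T p%:E) &
      forall p : \bar R, (p0%:E < p)%E \/ p = 0%E \/ p = 1%E ->
        isometry_to_lp (Hpw_analysis ip w Td T p)].
Proof.
move=> Xcount _ spec p0_gt0 p0_le1 adm _ [_ dual] sim.
have recon x := (dual x).1.
have Gb (p : \bar R) : (p0%:E < p)%E \/ p = 1%E ->
    mx_bounded w p (gramian ip Td T).
  by move=> pP; exact: adm.
have Grow k : exists M : R, forall D : {fset X},
    \sum_(l <- D) ropnorm (gramian ip Td T k l) / w (val l) <= M.
  apply: rowsum_bound; apply: adm; last by left; rewrite ltry.
  (* [bop_id] has norm at most 1, so the matrix of scaled identities is dominated entrywise by the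
     Gram matrix. *)
  apply: (spectral_solid spec sim _).1 => {}k l.
  apply: ge_ereal_sup => _ [x /= x1 <-].
  rewrite rnormZ rnorm_real ger0_norm ?ropnorm_ge0//.
  rewrite -[leRHS]fineK ?opnorm_fin// lee_fin.
  by rewrite ler_piMr// ropnorm_ge0.
have H00p (p : \bar R) : (p0%:E < p)%E \/ p = 0%E \/ p = 1%E ->
    forall x, H00_set ip T x -> lp_space w p (analysis Td x).
  move=> pP x xH; have [->|pN0] := eqVneq p 0%E.
    by apply/l1_l0/(H00_analysis_lty _ (Gb _ _) xH) => //; right.
  rewrite lp_spaceE//; apply: H00_analysis_lty (Gb _ _) _ xH => //.
  by case: pP => [|[/eqP|]]; [left|rewrite (negPf pN0)|right].
(* The range of the isometry claim contains the ranges of the other two; being nonnegative, it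
   excludes [-oo]. *)
pose good (p : \bar R) := (p0%:E < p)%E \/ p = 0%E \/ p = 1%E.
have good1 (p : \bar R) : (1 <= p)%E \/ p = 0%E -> good p.
  move=> [|->]; last by right; left.
  rewrite le_eqVlt => /predU1P[<-|p1]; first by right; right.
  by left; apply: le_lt_trans p1; rewrite lee_fin.
have p_ge0 (p : \bar R) : good p -> (0 <= p)%E.
  move=> [pp|[->//|->//]]; apply: le_trans (ltW pp).
  by rewrite lee_fin ltW.
have lin (p : \bar R) : good p -> linear (Hpw_analysis ip w Td T p).
  case: p => [r||] gp; last by have := p_ge0 _ gp.
    exact: (Hp_analysis_linear (H00p _ gp)).
  exact: Hinf_analysis_linear.
have mem (p : \bar R) : good p -> forall q,
    lp_space w p (Hpw_analysis ip w Td T p q).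
  case: p => [r||] gp q; last by have := p_ge0 _ gp.
    exact: (Hp_analysisP (H00p _ gp) q).1.
  exact: Hinf_analysis_lp.
have norm (p : \bar R) : good p -> forall q,
    lpnorm w p (Hpw_analysis ip w Td T p q) = Hpw_norm ip w Td T p q.
  case: p => [r||] gp q //; last by have := p_ge0 _ gp.
  exact: (Hp_analysis_norm (p_ge0 _ gp) (H00p _ gp)).
have inj (p : \bar R) : good p -> forall q,
    Hpw_analysis ip w Td T p q = 0 -> q = 0.
  case: p => [r||] gp q; last by have := p_ge0 _ gp.
    exact: (Hp_analysis_eq0 (H00p _ gp)).
  exact: Hinf_analysis_eq0.
have complete (p : \bar R) : good p ->
    seq_complete [set: Hpw ip w Td T p] (Hpw_norm ip w Td T p).
  move=> gp; apply: (isometry_complete (lin p gp) (mem p gp) (norm p gp)).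
  case: p gp => [r||] gp q c; last by have := p_ge0 _ gp.
    exact: (Hp_analysis_closed (H00p _ gp)).
  apply: Hinf_analysis_closed => //; apply: Gb; left; exact: ltry.
split=> [p p1|p p0p p1|p pP].
- have gp := good1 _ p1; split; last exact: complete.
  exact: (isometry_norm (lin p gp) (mem p gp) (norm p gp) (inj p gp) p1).
- have gp : good p%:E by left.
  split; last exact: complete.
  exact: (isometry_quasi_norm (lin _ gp) (mem _ gp) (norm _ gp) (inj _ gp)).
- split=> [|q]; first exact: lin.
  by split; [exact: mem|exact: norm].
Qed.
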